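(* Let $m,n\in\mathbb{N}$, let $T_0>1$ and let $\psi:[T_0,\infty)\to\mathbb{R}_+$ be non-increasing. Let $\widehat{D}_{m,n}(\psi)$ be the set of pairs $(A,\mathbf b)\in M_{m,n}\times\mathbb{R}^m$ for which there is $T_1$ such that for every $T\ge T_1$ there exist $\mathbf p\in\mathbb{Z}^m$, $\mathbf q\in\mathbb{Z}^n$ with $$\|A\mathbf q+\mathbf b-\mathbf p\|^m<\psi(T)\quad\text{and}\quad \|\mathbf q\|^n<T.$$ Then $\widehat{D}_{m,n}(\psi)$ has Lebesgue measure zero if and only if the series $\sum_j \frac{1}{\psi(j)j^2}$ diverges, and $\widehat{D}_{m,n}(\psi)$ has full Lebesgue measure (its complement in $M_{m,n}\times\mathbb{R}^m$ is null) if and only if this series converges.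
   Context: $M_{m,n}$ denotes the space of real $m\times n$ matrices, identified with $\mathbb{R}^{mn}$ and equipped with Lebesgue measure; $\|\cdot\|$ denotes the supremum norm on $\mathbb{R}^k$ for any $k$. *)

(* Defs.v *)
From HB Require Import structures.
From mathcomp Require Import all_boot all_order all_algebra.
From mathcomp Require Import all_classical all_reals all_analysis.

Set Implicit Arguments.
Unset Strict Implicit.
Unset Printing Implicit Defensive.

Import Order.TTheory GRing.Theory Num.Theory.
Import numFieldNormedType.Exports.

Local Open Scope classical_set_scope.
Local Open Scope ring_scope.

Section lebesgue_tuple_step.
Context {R : realType} (k : nat).

Definition cons_pair (z : measurableTypeR R * k.-tuple (measurableTypeR R)) :
  k.+1.-tuple (measurableTypeR R) := [tuple of z.1 :: z.2].

Lemma measurable_cons_pair : measurable_fun setT cons_pair.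
Proof. exact: measurable_cons. Qed.

Variable mu : {sigma_finite_measure set (k.-tuple (measurableTypeR R)) -> \bar R}.

Definition lebesgue_tupleS : set (k.+1.-tuple (measurableTypeR R)) -> \bar R :=
  pushforward (@lebesgue_measure R \x mu)%E cons_pair.

Let lebesgue_tupleS0 : lebesgue_tupleS set0 = 0%E.
Proof. by rewrite /lebesgue_tupleS /pushforward preimage_set0 measure0. Qed.

Let lebesgue_tupleS_ge0 A : (0 <= lebesgue_tupleS A)%E.
Proof. by rewrite /lebesgue_tupleS /pushforward; exact: measure_ge0. Qed.

Let lebesgue_tupleS_sigma_additive : semi_sigma_additive lebesgue_tupleS.
Proof.
move=> F mF tF mUF; rewrite /lebesgue_tupleS /pushforward preimage_bigcup.
apply: measure_semi_sigma_additive.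
- move=> n; rewrite -[X in measurable X]setTI; exact: measurable_cons_pair.
- apply/trivIsetP => /= i j _ _ ij; rewrite -preimage_setI.
  by move/trivIsetP : tF => /(_ _ _ _ _ ij) ->//; rewrite preimage_set0.
- rewrite -preimage_bigcup -[X in measurable X]setTI.
  exact: measurable_cons_pair.
Qed.

HB.instance Definition _ := isMeasure.Build _ _ _ lebesgue_tupleS
  lebesgue_tupleS0 lebesgue_tupleS_ge0 lebesgue_tupleS_sigma_additive.

Lemma lebesgue_tupleSX (A : set (measurableTypeR R))
    (B : set (k.-tuple (measurableTypeR R))) :
  measurable A -> measurable B ->
  lebesgue_tupleS [set t | A (thead t) /\ B [tuple of behead t]]
  = (lebesgue_measure A * mu B)%E.
Proof.
move=> mA mB; rewrite -product_measure1E// /lebesgue_tupleS /pushforward.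
congr (product_measure1 _ _ _); apply/seteqP.
have E (z : measurableTypeR R * k.-tuple (measurableTypeR R)) :
    [tuple of behead (cons_pair z)] = z.2 by apply/val_inj.
by split => z /=; rewrite E theadE.
Qed.

Let lebesgue_tupleS_sigma_finite : sigma_finite setT lebesgue_tupleS.
Proof.
have /sigma_finiteP[F [TF ndF Foo]] := sigma_finiteT (@lebesgue_measure R).
have /sigma_finiteP[G [TG ndG Goo]] := sigma_finiteT mu.
exists (fun n => [set t | F n (thead t) /\ G n [tuple of behead t]]).
  rewrite predeqE => t; split => // _.
  have [n _ Fn] : (\bigcup_n F n) (thead t) by rewrite -TF.
  have [p _ Gp] : (\bigcup_n G n) [tuple of behead t] by rewrite -TG.
  exists (maxn n p) => //; split.
  - by move: (thead t) Fn; exact/subsetPset/ndF/leq_maxl.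
  - by move: [tuple of behead t] Gp; exact/subsetPset/ndG/leq_maxr.
move=> n; have [? ?] := Foo n; have [? ?] := Goo n.
split; last by rewrite lebesgue_tupleSX// lte_mul_pinfty// ge0_fin_numE.
apply: measurableI.
- rewrite -[X in measurable X]setTI.
  exact: (@measurable_tnth _ (measurableTypeR R) k.+1 ord0).
- rewrite -[X in measurable X]setTI.
  exact: (@measurable_behead _ (measurableTypeR R) k).
Qed.

HB.instance Definition _ := Measure_isSigmaFinite.Build _ _ _ lebesgue_tupleS
  lebesgue_tupleS_sigma_finite.

End lebesgue_tuple_step.

(* Lebesgue measure on the Borel sets of R^k, R^k being the type of k-tuples;
   for k = 0 it is the unit mass on the one-point space *)
Fixpoint lebesgue_tuple (R : realType) (k : nat) :
    {sigma_finite_measure set (k.-tuple (measurableTypeR R)) -> \bar R} :=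
  match k with
  | 0 => dirac ([tuple] : 0.-tuple (measurableTypeR R))
  | k'.+1 => lebesgue_tupleS (lebesgue_tuple R k')
  end.

Lemma lebesgue_tuple_box (R : realType) (k : nat)
    (A : 'I_k -> set (measurableTypeR R)) :
  (forall i, measurable (A i)) ->
  lebesgue_tuple R k [set t | forall i, A i (tnth t i)]
  = (\prod_(i < k) lebesgue_measure (A i))%E.
Proof.
elim: k A => [|k ih] A mA.
  rewrite big_ord0 /= diracE mem_set//.
  by case.
rewrite big_ord_recl -ih// -lebesgue_tupleSX//.
  congr (lebesgue_tupleS _ _); apply/seteqP; split => t /=.
    move=> h; split; first exact: h.
    by move=> i; have := h (lift ord0 i); rewrite {1}(tuple_eta t) tnthS.
  move=> [h0 h] i; case: (unliftP ord0 i) => [j ->|->//].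
  by rewrite (tuple_eta t) tnthS; exact: h.
rewrite (_ : [set t | _] =
    \bigcap_(i in setT) ((@tnth k _) ^~ i @^-1` A (lift ord0 i))).
  apply: fin_bigcap_measurable => // i _; rewrite -[X in measurable X]setTI.
  exact: measurable_tnth.
by apply/seteqP; split => t /= h i; [move=> _|]; exact: h.
Qed.

Section uniform_approximation.
Context {R : realType}.

Definition mx_of_tuple (m n : nat) (t : (m * n).-tuple (measurableTypeR R)) :
  'M[R]_(m, n) := \matrix_(i, j) tnth t (mxvec_index i j).

Definition cV_of_tuple (m : nat) (t : m.-tuple (measurableTypeR R)) :
  'cV[R]_m := \col_i tnth t i.

(* [negligible] means contained in a Borel set of measure zero, that is, null
   for the completed measure. *)
Definition lebesgue_null (m n : nat) (S : set ('M[R]_(m, n) * 'cV[R]_m)) :=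
  (lebesgue_tuple R (m * n) \x lebesgue_tuple R m)%E.-negligible
    [set z | S (mx_of_tuple z.1, cV_of_tuple z.2)].

(* The norm of mathcomp-analysis on matrices is the supremum norm. The values
   of [psi] on ]-oo, T0[ are irrelevant, which is why T1 >= T0. *)
Definition Dhat (m n : nat) (T0 : R) (psi : R -> R) :
    set ('M[R]_(m, n) * 'cV[R]_m) :=
  [set Ab | exists2 T1 : R, T0 <= T1 & forall T : R, T1 <= T ->
     exists (p : 'cV[int]_m) (q : 'cV[int]_n),
       `|Ab.1 *m map_mx intr q + Ab.2 - map_mx intr p| ^+ m < psi T /\
       `|map_mx intr q : 'cV[R]_n| ^+ n < T].

(* Partial sums of \sum_j 1 / (psi(j) j^2) over the integers j >= T0, where psi
   is defined. *)
Definition inv_psi_series (T0 : R) (psi : R -> R) : R^nat :=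
  fun N => \sum_(0 <= j < N | T0 <= j%:R) (psi j%:R * j%:R ^+ 2)^-1.

End uniform_approximation.

(* Main.v *)
Require Import Defs.
From HB Require Import structures.
From mathcomp Require Import all_boot all_order all_algebra.
From mathcomp Require Import all_classical all_reals all_analysis.
From mathcomp Require Import measurable_realfun.
From mathcomp Require Import ring lra zify.

Set Implicit Arguments.
Unset Strict Implicit.
Unset Printing Implicit Defensive.

Import Order.TTheory GRing.Theory Num.Theory.
Import numFieldNormedType.Exports.

Local Open Scope classical_set_scope.
Local Open Scope ring_scope.

(**
Everything is invariant under integer translations, so the measure is that of a
torus; write [|x|_Z] for the distance of [x] to the integers.

Convergence.  For fixed [T = 2^(n k)] the points [A q + b], with [q] in a box of
[T] integer vectors, are uniform on the torus and pairwise independent.  By the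
second moment method the probability that none of them is within [psi^(1/m)] of
[0] is [O(1 / (T psi))], and the Borel-Cantelli lemma applies.

Divergence.  If some nonzero integer vector [u] satisfies [|u| << psi^(-1/m)],
[|A^T u|_Z << T^(-1/n)] and [|u . b|_Z >= 1/4], then [u . (A q + b)] stays away
from the integers for all [|q| < T^(1/n)], so that no [A q + b] is close to an
integer point.  For [m >= 2] these events are pairwise independent for pairwise
non-parallel [u]; for [m = 1] they are quasi-independent as soon as one only
approximates by reduced fractions with denominators [u << phi(u)].  Hence the
complement of the set has probability at least a constant that depends only on
[n], and not on [psi].  Doubling [(A, b)] multiplies [psi] by [2^m], so the
union of these sets over all multiples [2^(m l) psi] is invariant under the
ergodic doubling map, and its measure is [0] since it is not [1].
*)

(** The series arises in the same way in both halves. About [1 / psi(T)] integer vectors [u] meet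
    the size condition of the obstruction, each obstructs with probability comparable to [1 / T],
    and the sum of [1 / (T psi(T))] over [T = 2^(n k)] is the given series by Cauchy condensation.
    The obstacle in the divergence half is that one vector serves at many scales, where its events
    are strongly dependent. Each [u] is therefore used once, at the first scale that admits it; as
    the probabilities decay geometrically with the scale, at least half of the divergent sum
    survives. Second moments then yield only a positive probability of failure, and the set itself
    need not be stable under doubling, which is why all multiples of [psi] are treated at once.
    Events defined by integer linear forms are measured without Fourier analysis: they are averaged
    over translates of [(A, b)] obtained from a small linear system, so that the forms move by
    independent uniform amounts. *)

Local Notation space R k l :=
  (k.-tuple (measurableTypeR R) * l.-tuple (measurableTypeR R))%type.

(** * Coordinates and dyadic cubes *)

(* A constant of its own, so that it can be given a sigma-finite structure,
   which is not inferred for products. *)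
Definition lam (R : realType) (k l : nat) : set (space R k l) -> \bar R :=
  (lebesgue_tuple R k \x lebesgue_tuple R l)%E.
HB.instance Definition _ (R : realType) (k l : nat) := Measure.on (@lam R k l).
Arguments lam : clear implicits.

Section spaces.
Context {R : realType}.

(** A sum type as index set treats the entries of the matrix and of the vector alike, so that the
    space is a single product of lines. *)
Definition coord k l (z : space R k l) (i : 'I_k + 'I_l) : R :=
  match i with inl i => tnth z.1 i | inr i => tnth z.2 i end.

Definition of_coord k l (f : 'I_k + 'I_l -> R) : space R k l :=
  ([tuple f (inl i) | i < k], [tuple f (inr i) | i < l]).

Lemma coordK k l (f : 'I_k + 'I_l -> R) i : coord (of_coord f) i = f i.
Proof. by case: i => i; rewrite /coord/= tnth_mktuple. Qed.

Lemma measurable_coord k l (i : 'I_k + 'I_l) :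
  measurable_fun setT (fun z : space R k l => coord z i : measurableTypeR R).
Proof.
case: i => i /=.
  by apply: (measurableT_comp (measurable_tnth i)); exact: measurable_fst.
by apply: (measurableT_comp (measurable_tnth i)); exact: measurable_snd.
Qed.

Lemma measurable_fun_coord d (T : measurableType d) k l (h : T -> space R k l) :
  (forall i,
    measurable_fun setT (fun x => coord (h x) i : measurableTypeR R)) ->
  measurable_fun setT h.
Proof.
move=> mh; apply/measurable_fun_pairP; split; apply/measurable_fun_tnthP => i.
- exact: (mh (inl i)).
- exact: (mh (inr i)).
Qed.

Lemma measurable_coord_preimage k l (i : 'I_k + 'I_l) (A : set R) :
  measurable (A : set (measurableTypeR R)) ->
  measurable [set z : space R k l | A (coord z i)].
Proof.
by move=> mA; rewrite -[X in measurable X]setTI; exact: measurable_coord.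
Qed.

Lemma measurable_forall d (T : measurableType d) (I : finType)
    (A : I -> set T) : (forall i, measurable (A i)) ->
  measurable [set z | forall i, A i z].
Proof.
move=> mA.
rewrite (_ : [set z | _] = \bigcap_(i in setT) A i).
  exact: fin_bigcap_measurable.
by apply/seteqP; split => z /= h i; [move=> _|]; exact: h.
Qed.

Lemma lam_box k l (A : 'I_k + 'I_l -> set R) :
  (forall i, measurable (A i : set (measurableTypeR R))) ->
  lam R k l [set z | forall i, A i (coord z i)]
  = (\prod_i lebesgue_measure (A i : set (measurableTypeR R)))%E.
Proof.
move=> mA; rewrite big_sumType/= -!lebesgue_tuple_box//.
rewrite -product_measure1E//; last 2 first.
- apply: measurable_forall => i; rewrite -[X in measurable X]setTI.
  exact: measurable_tnth.
- apply: measurable_forall => i; rewrite -[X in measurable X]setTI.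
  exact: measurable_tnth.
congr (lam _ _ _ _); apply/seteqP; split => z /=.
  by move=> h; split => i; [exact: (h (inl i))|exact: (h (inr i))].
by move=> [h1 h2] [i|i]; [exact: h1|exact: h2].
Qed.

(** The half-open dyadic cube of side [2 ^- p] with corner [a / 2 ^ p]. Floors make the cubes of one
    generation a partition, with no boundary cases. *)
Definition dcube k l (p : nat) (a : {ffun 'I_k + 'I_l -> int}) : set (space R k
  l) :=
  [set z | forall i, Num.floor (2 ^+ p * coord z i) = a i].

Lemma floor_dyadic_itv (p : nat) (a : int) :
  [set x : R | Num.floor (2 ^+ p * x) = a] =
  `[a%:~R / 2 ^+ p, (a + 1)%:~R / 2 ^+ p[%classic.
Proof.
have p0 : 0 < 2 ^+ p :> R by rewrite exprn_gt0.
apply/seteqP; split => x /=; rewrite in_itv/= ler_pdivrMr// ltr_pdivlMr// [x *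
  _]mulrC.
  by move=> /eqP; rewrite floor_eq.
by move=> h; apply/eqP; rewrite floor_eq.
Qed.

Lemma measurable_floor_dyadic (p : nat) (a : int) :
  measurable ([set x : R | Num.floor (2 ^+ p * x) = a] : set (measurableTypeR
    R)).
Proof. by rewrite floor_dyadic_itv; exact: measurable_itv. Qed.

Lemma measurable_dcube k l p (a : {ffun 'I_k + 'I_l -> int}) :
  measurable (dcube p a).
Proof.
apply: measurable_forall => i.
exact: (measurable_coord_preimage i (measurable_floor_dyadic p (a i))).
Qed.

Lemma lebesgue_floor_dyadic p (a : int) : 
  lebesgue_measure ([set x : R | Num.floor (2 ^+ p * x) = a] : set
    (measurableTypeR R))
  = (2 ^- p)%:E.
Proof.
have p0 : 0 < 2 ^+ p :> R by rewrite exprn_gt0.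
rewrite floor_dyadic_itv lebesgue_measure_itv/= lte_fin ltr_pM2r ?invr_gt0//.
rewrite ltr_int ltzD1 lexx -EFinD -mulrBl intrD addrAC subrr add0r.
by rewrite mul1r.
Qed.

Lemma prode_EFin (I : finType) (F : I -> R) :
  (\prod_i (F i)%:E)%E = (\prod_i F i)%:E.
Proof. by rewrite (big_morph EFin EFinM erefl). Qed.

Lemma lam_dcube k l p (a : {ffun 'I_k + 'I_l -> int}) :
  lam R k l (dcube p a) = ((2 ^- p) ^+ (k + l))%:E.
Proof.
rewrite (lam_box (A := fun i => [set x | Num.floor (2 ^+ p * x) = a i])).
  under eq_bigr do rewrite lebesgue_floor_dyadic.
  by rewrite prode_EFin prodr_const card_sum !card_ord.
by move=> i; exact: measurable_floor_dyadic.
Qed.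

Lemma bigcup_dcube k l :
  \bigcup_n (if unpickle n is Some a then dcube 0 a else set0) = [set: space R
    k l].
Proof.
apply/seteqP; split => // z _.
exists (pickle [ffun i => Num.floor (2 ^+ 0 * coord z i)]) => //.
by rewrite pickleK => i; rewrite ffunE.
Qed.

Lemma lam_sigma_finite k l : sigma_finite setT (lam R k l).
Proof.
exists (fun n => if unpickle n is Some a then dcube 0 a else set0).
  by rewrite bigcup_dcube.
move=> n; case: unpickle => [a|]; last by rewrite measure0; split.
by split; [exact: measurable_dcube|rewrite lam_dcube ltry].
Qed.

(** An integer [c] is at most [2 ^ p x] exactly when [2 ^ (p' - p) c] is at most [2 ^ p' x], which
    depends only on the finer floor. Hence dyadic cubes are nested or disjoint. *)
Lemma floor_dyadic_coarsen (p p' : nat) (x y : R) : (p <= p')%N ->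
  Num.floor (2 ^+ p' * x) = Num.floor (2 ^+ p' * y) ->
  Num.floor (2 ^+ p * x) = Num.floor (2 ^+ p * y).
Proof.
move=> pp' e.
suff H (x0 y0 : R) : Num.floor (2 ^+ p' * x0) = Num.floor (2 ^+ p' * y0) ->
    Num.floor (2 ^+ p * x0) <= Num.floor (2 ^+ p * y0).
  by apply/eqP; rewrite eq_le !H.
move=> {}e; rewrite floor_ge_int.
set c := Num.floor (2 ^+ p * x0).
have h : c%:~R <= 2 ^+ p * x0 by exact: floor_le.
have : 2 ^+ (p' - p) * c%:~R <= 2 ^+ p' * y0.
  have -> : 2 ^+ (p' - p) * c%:~R = (2 ^+ (p' - p) * c)%:~R :> R.
    by rewrite intrM rmorphXn/=.
  rewrite -floor_ge_int -e floor_ge_int intrM rmorphXn/=.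
  by rewrite -[in leRHS](subnK pp') exprD -mulrA ler_pM2l ?exprn_gt0.
by rewrite -[in leRHS](subnK pp') exprD -mulrA ler_pM2l ?exprn_gt0.
Qed.

Definition dcubes k l : set (set (space R k l)) :=
  [set A | A = set0 \/ exists p a, A = dcube p a].
Arguments dcubes : clear implicits.

Lemma setI_closed_dcubes k l : setI_closed (dcubes k l).
Proof.
have sub p p' (a a' : {ffun 'I_k + 'I_l -> int}) z : (p <= p')%N ->
    dcube p a z -> dcube p' a' z -> dcube p' a' `<=` dcube p a.
  move=> pp' az az' y ay i; rewrite -az; apply: floor_dyadic_coarsen pp' _.
  by rewrite ay az'.
move=> A B [->|[p [a ->]]]; first by rewrite set0I; left.
move=> [->|[p' [a' ->]]]; first by rewrite setI0; left.
have [[z [az az']]|h] := pselect (exists z, dcube p a z /\ dcube p' a' z).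
  right; have [pp'|/ltnW pp'] := leqP p p'.
    by exists p', a'; apply/setIidPr; exact: sub az az'.
  by exists p, a; apply/setIidPl; exact: sub az' az.
left; apply/seteqP; split => // z [az az']; apply: h; by exists z.
Qed.

(** The half-space [coord z i < x] is the countable union of the dyadic cubes whose right end in
    direction [i] is at most [x]. *)
Lemma measurable_dcubes k l :
  (measurable : set (set (space R k l))) = <<s dcubes k l >>.
Proof.
apply/seteqP; split; last first.
  apply: smallest_sub; first exact: sigma_algebra_measurable.
  by move=> A [->|[p [a ->]]]; [exact: measurable0|exact: measurable_dcube].
have mid : measurable_fun setT
    (id : g_sigma_algebraType (dcubes k l) -> space R k l).
  apply: measurable_fun_coord => i.
  apply: (measurability _ (measurable_realfun.RGenInftyO.measurableE R)).
  move=> _ [_ [x ->] <-]; rewrite setTI.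
  rewrite (_ : _ @^-1` _ = \bigcup_(pa in [set: nat * {ffun 'I_k + 'I_l ->
    int}])
      (if ((pa.2 i + 1)%:~R / 2 ^+ pa.1 <= x) then dcube pa.1 pa.2 else set0)).
    apply: countable_bigcupT_measurable; first exact: countableP.
    move=> [p a] /=; case: ifPn => _; last exact: measurable0.
    by apply: sub_sigma_algebra; right; exists p, a.
  apply/seteqP; split => z /=.
    rewrite in_itv/= => zx.
    have [p hp] : exists p : nat, 2 ^- p < x - coord z i.
      have d0 : 0 < x - coord z i by rewrite subr_gt0.
      exists (Num.bound (x - coord z i)^-1).
      rewrite invf_plt ?posrE ?exprn_gt0//.
      have d1 : 0 <= (x - coord z i)^-1 by rewrite invr_ge0 ltW.
      apply: (lt_le_trans (archi_boundP d1)).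
      by rewrite -natrX ler_nat ltnW// ltn_expl.
    exists (p, [ffun j => Num.floor (2 ^+ p * coord z j)]) => //=.
    rewrite ifT; last first.
      have p0 : 0 < 2 ^+ p :> R by rewrite exprn_gt0.
      rewrite ffunE ler_pdivrMr// intrD.
      have h := floor_le (2 ^+ p * coord z i).
      apply: le_trans (_ : 2 ^+ p * coord z i + 1 <= _);
        first by rewrite lerD2r.
      have : 2 ^- p * 2 ^+ p <= (x - coord z i) * 2 ^+ p.
        by rewrite ler_pM2r// ltW.
      rewrite mulVf ?gt_eqF// mulrBl => {}h; rewrite [2 ^+ p * _]mulrC; lra.
    by move=> j; rewrite ffunE.
  move=> [[p a] _ /=]; case: ifPn => // h az; rewrite in_itv/=.
  apply: lt_le_trans h.
  rewrite ltr_pdivlMr ?exprn_gt0// -(az i) mulrC.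
  by have /andP[] := floor_itv (2 ^+ p * coord z i).
by move=> A mA; have := mid measurableT A mA; rewrite setTI.
Qed.

(** Dyadic cubes form a generating pi-system, and unit cubes of finite measure cover the space.
    Identities between measures are thereby reduced to cubes, where they split into one-dimensional
    ones. *)
Lemma dyadic_unique k l (m1 m2 : {measure set (space R k l) -> \bar R}) :
  (forall p a, m1 (dcube p a) = m2 (dcube p a)) ->
  (forall a, m1 (dcube 0 a) < +oo)%E ->
  forall A, measurable A -> m1 A = m2 A.
Proof.
move=> m12 fin.
pose g (n : nat) : set (space R k l) :=
  if unpickle n is Some a then dcube 0 a else set0.
apply: (measure_unique (dcubes k l) g).
- exact: measurable_dcubes.
- exact: setI_closed_dcubes.
- by move=> n; rewrite /g; case: unpickle => [a|]; [right; exists 0%N, a|left].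
- exact: bigcup_dcube.
- by move=> A [->|[p [a ->]]//]; rewrite !measure0.
- by move=> n; rewrite /g; case: unpickle => [a|]//; rewrite measure0.
Qed.

End spaces.

HB.instance Definition _ (R : realType) (k l : nat) :=
  Measure_isSigmaFinite.Build _ _ _ (lam R k l) (@lam_sigma_finite R k l).

(** * Translations of the torus *)

Section circle.
Context {R : realType}.
Local Notation mu := (@lebesgue_measure R).

Lemma measurable_addr_preimage (A : set R) (w : R) :
  measurable (A : set (measurableTypeR R)) ->
  measurable ([set x | A (x + w)] : set (measurableTypeR R)).
Proof.
move=> mA; rewrite -[X in measurable X]setTI.
have /(_ measurableT A mA) : measurable_fun setT
    (fun x : measurableTypeR R => x + w : measurableTypeR R).
  exact: measurable_funD.
by [].
Qed.

Lemma lebesgue_shift (A : set R) (w : R) :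
  measurable (A : set (measurableTypeR R)) ->
  mu [set x | A (x + w)] = mu A.
Proof.
move=> mA.
have mf : measurable_fun setT
    (fun x : measurableTypeR R => x + w : measurableTypeR R).
  exact: measurable_funD.
change (pushforward mu (fun x : measurableTypeR R => x + w : measurableTypeR R)
  A
  = mu A).
apply/esym/lebesgue_measure_unique => //= _ [[a b]] _ <-.
rewrite /pushforward (_ : _ @^-1` _ = `]a - w, b - w]%classic).
  rewrite !lebesgue_measure_itv/= !lte_fin ltrD2r -!EFinD.
  by case: ifPn => // _; congr EFin; lra.
by apply/seteqP; split => x /=; rewrite !in_itv/= lerBrDr ltrBlDr.
Qed.

Definition periodic1 (S : set R) := forall x (a : int), S (x + a%:~R) <-> S x.

Lemma circle_shift (S : set R) (w : R) :
  measurable (S : set (measurableTypeR R)) -> periodic1 S ->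
  mu (`[0, 1[%classic `&` [set x | S (x + w)]) = mu (`[0, 1[%classic `&` S).
Proof.
move=> mS pS; set w0 := w - (Num.floor w)%:~R.
have /andP[w00 w01] : 0 <= w0 < 1.
  have /andP[h1 h2] := floor_itv w; rewrite /w0 subr_ge0 h1/= ltrBlDr addrC.
  by rewrite intrD in h2.
have -> : [set x | S (x + w)] = [set x | S (x + w0)].
  apply/seteqP; split => x /=; rewrite /w0 addrA => h.
    by rewrite -mulrNz; apply/pS.
  by move: h; rewrite -mulrNz => /pS.
have -> : `[0, 1[%classic `&` [set x | S (x + w0)] =
    [set x | (`[w0, 1 + w0[%classic `&` S) (x + w0)].
  by apply/seteqP; split => x /=; rewrite !in_itv/= lerDr ltrD2r.
rewrite lebesgue_shift; last by apply: measurableI => //; exact: measurable_itv.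
have split2 (a b c : R) : a <= b -> b <= c ->
    mu (`[a, c[%classic `&` S) =
    (mu (`[a, b[%classic `&` S) + mu (`[b, c[%classic `&` S))%E.
  move=> ab bc; rewrite -measureU.
  - congr (mu _); rewrite -setIUl; congr (_ `&` _).
    apply/seteqP; split => x /=; rewrite !in_itv/=.
      by case: (ltP x b) => xb /andP[-> xc]; [left|right].
    move=> [/andP[-> xb]|/andP[xb ->]]; first by rewrite (lt_le_trans xb).
    by rewrite (le_trans ab).
  - by apply: measurableI => //; exact: measurable_itv.
  - by apply: measurableI => //; exact: measurable_itv.
  - apply/seteqP; split => // x [[/=]]; rewrite !in_itv/=.
    by move=> /andP[_ xb] _ [/andP[]]; rewrite leNgt xb.
(* Cut the translated interval at [1]; by periodicity the overhang from [1] to [1 + w0] has the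
   measure of the missing part from [0] to [w0]. *)
rewrite (split2 w0 1 (1 + w0)) ?(ltW w01) ?lerDl//.
rewrite (split2 0 w0 1) ?(ltW w01)// addeC; congr (_ + _)%E.
rewrite -(lebesgue_shift 1); last first.
  by apply: measurableI => //; exact: measurable_itv.
congr (mu _); apply/seteqP; split => x /= [];
    rewrite !in_itv/= => h /= hS; (split; last exact/(pS x 1)).
  lra.
lra.
Qed.

Lemma measurable_floor_fun :
  measurable_fun setT (fun x : measurableTypeR R => (Num.floor x)%:~R :
    measurableTypeR R).
Proof.
move=> _ Y mY; rewrite setTI.
rewrite (_ : _ @^-1` _ = \bigcup_(a in [set: int])
   (if `[< Y a%:~R >] then [set x : R | Num.floor (2 ^+ 0 * x) = a] else set0)).
  apply: countable_bigcupT_measurable; first exact: countableP.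
  move=> a; case: ifPn => _; last exact: measurable0.
  exact: measurable_floor_dyadic.
apply/seteqP; split => x /=.
  move=> h; exists (Num.floor x) => //; case: asboolP => //= _.
  by rewrite expr0 mul1r.
by move=> [a _]; case: asboolP => //= h; rewrite expr0 mul1r => ->.
Qed.

End circle.

Section torus.
Context {R : realType}.

Definition ucube k l : set (space R k l) :=
  [set z | forall i, 0 <= coord z i < 1].
Arguments ucube : clear implicits.

Lemma ucubeE k l : ucube k l = dcube 0 [ffun=> 0].
Proof.
apply/seteqP; split => z h i; have := h i; rewrite ffunE expr0 mul1r.
  by move=> h1; apply/eqP; rewrite floor_eq.
by move/eqP; rewrite floor_eq.
Qed.

Lemma measurable_ucube k l : measurable (ucube k l).
Proof. by rewrite ucubeE; exact: measurable_dcube. Qed.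

Lemma lam_ucube k l : lam R k l (ucube k l) = 1%E.
Proof. by rewrite ucubeE lam_dcube expr0 invr1 expr1n. Qed.

Definition shift k l (z : space R k l) (f : 'I_k + 'I_l -> R) : space R k l :=
  of_coord (fun i => coord z i + f i).

Definition periodic k l (S : set (space R k l)) :=
  forall z (a : 'I_k + 'I_l -> int), S (shift z (fun i => (a i)%:~R)) <-> S z.

Lemma measurable_shift k l (w : 'I_k + 'I_l -> R) :
  measurable_fun setT (fun z : space R k l => shift z w).
Proof.
apply: measurable_fun_coord => i.
rewrite (_ : (fun _ => _) = fun z : space R k l => coord z i + w i).
  by apply: measurable_funD => //; exact: measurable_coord.
by apply/funext => z; rewrite coordK.
Qed.

Lemma dyadic_unique_image d (T : measurableType d) k l (f : T -> space R k l)
    (m : {measure set T -> \bar R}) (m2 : {measure set (space R k l) -> \bar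
      R}) :
  measurable_fun setT f ->
  (forall p a, m (f @^-1` dcube p a) = m2 (dcube p a)) ->
  (forall a, m2 (dcube 0 a) < +oo)%E ->
  forall A, measurable A -> m (f @^-1` A) = m2 A.
Proof.
move=> mf h fin A mA; change (pushforward m f A = m2 A); apply/esym.
by apply: dyadic_unique => // p a; rewrite /= /pushforward h.
Qed.

Lemma lam_shift k l (A : set (space R k l)) w : measurable A ->
  lam R k l [set z | A (shift z w)] = lam R k l A.
Proof.
apply: (dyadic_unique_image (f := fun z => shift z w)).
- exact: measurable_shift.
- move=> p a.
  rewrite (_ : _ @^-1` _ = [set z | forall i,
    [set x : R | Num.floor (2 ^+ p * (x + w i)) = a i] (coord z i)]);
      last first.
    by apply/seteqP; split => z h i; have := h i; rewrite coordK.
  apply: (etrans (lam_box (A := fun i =>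
      [set x : R | Num.floor (2 ^+ p * (x + w i)) = a i]) _)).
    by move=> i; apply: (measurable_addr_preimage (w i)
      (measurable_floor_dyadic p (a i))).
  apply: (etrans _ (esym (lam_box (A := fun i =>
      [set x : R | Num.floor (2 ^+ p * x) = a i]) _))).
    apply: eq_bigr => i _.
    exact: (lebesgue_shift (w i) (measurable_floor_dyadic p (a i))).
  by move=> i; exact: measurable_floor_dyadic.
- by move=> a; rewrite /= lam_dcube ltry.
Qed.

Definition frac (x : R) : R := x - (Num.floor x)%:~R.

Lemma frac_id (x : R) : 0 <= x < 1 -> frac x = x.
Proof. by move=> h; rewrite /frac (_ : Num.floor x = 0) ?subr0//; apply/eqP;
  rewrite floor_eq. Qed.

Lemma frac_addz (x : R) (a : int) : frac (x + a%:~R) = frac x.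
Proof.
rewrite /frac (_ : Num.floor (x + a%:~R) = Num.floor x + a).
  by rewrite intrD opprD addrACA subrr addr0.
apply/eqP; rewrite floor_eq !intrD; have := floor_itv x.
by rewrite intrD lerD2r addrAC ltrD2r.
Qed.

Lemma measurable_frac :
  measurable_fun setT (fun x : measurableTypeR R => frac x : measurableTypeR R).
Proof. by apply: measurable_funB => //; exact: measurable_floor_fun. Qed.

Lemma torus_shift k l (S : set (space R k l)) w : measurable S -> periodic S ->
  lam R k l (ucube k l `&` [set z | S (shift z w)]) =
  lam R k l (ucube k l `&` S).
Proof.
(* Reducing the translate modulo 1 does not change membership in the periodic [S]. That [g]
   preserves Lebesgue measure on the unit cube can be checked on dyadic cubes, one coordinate at a
   time. *)
move=> mS pS; pose g (z : space R k l) : space R k l := of_coord (fun i => frac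
  (coord z i + w i)).
have mg : measurable_fun setT g.
  apply: measurable_fun_coord => i.
  rewrite (_ : (fun _ => _) = fun z : space R k l => frac (coord z i + w i)).
    apply: (measurableT_comp measurable_frac).
    by apply: measurable_funD => //; exact: measurable_coord.
  by apply/funext => z; rewrite coordK.
have -> : [set z | S (shift z w)] = g @^-1` S.
  apply/seteqP; split => z /= h.
    apply/(pS _ (fun i => Num.floor (coord z i + w i))).
    suff -> : shift (g z) (fun i => (Num.floor (coord z i + w i))%:~R) = shift
      z w by [].
    by congr of_coord; apply/funext => i; rewrite coordK /frac subrK.
  suff -> : shift z w = shift (g z) (fun i => (Num.floor (coord z i + w
    i))%:~R) by exact/pS.
  by congr of_coord; apply/funext => i; rewrite coordK /frac subrK.
rewrite 2!(setIC (ucube k l)).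
pose m := mrestr (lam R k l) (@measurable_ucube k l).
change (m (g @^-1` S) = m S).
apply: dyadic_unique_image => //; last first.
  move=> a; rewrite /= /mrestr; apply: le_lt_trans (_ : lam R k l (ucube k l) <
    _)%E.
    apply: le_measure; rewrite ?inE//; last exact: measurable_ucube.
    by apply: measurableI; [exact: measurable_dcube|exact: measurable_ucube].
  by rewrite lam_ucube ltry.
move=> p a; rewrite /= /mrestr.
have mS1 i : measurable ([set x : R | Num.floor (2 ^+ p * frac x) = a i] : set
  (measurableTypeR R)).
  by rewrite -[X in measurable X]setTI; exact: (measurable_frac measurableT
    (measurable_floor_dyadic p (a i))).
rewrite (_ : _ @^-1` _ `&` _ = [set z | forall i,
    (`[0, 1[%classic `&` [set x : R | Num.floor (2 ^+ p * frac (x + w i)) = a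
      i]) (coord z i)]); last first.
  apply/seteqP; split => z.
    by move=> [h1 h2] i; split; [rewrite /= in_itv/=; exact: h2|have := h1 i;
      rewrite coordK].
  move=> h; split => i; have [h1 h2] := h i; first by rewrite coordK.
  by move: h1; rewrite /= in_itv.
rewrite (_ : dcube _ _ `&` _ = [set z | forall i,
    (`[0, 1[%classic `&` [set x : R | Num.floor (2 ^+ p * frac x) = a i])
      (coord z i)]); last first.
  apply/seteqP; split => z.
    move=> [h1 h2] i; split; first by rewrite /= in_itv/=; exact: h2.
    by rewrite /= frac_id//; exact: h1.
  move=> h; split => i; have [h1 h2] := h i; last by move: h1;
    rewrite /= in_itv.
  by move: h1 h2; rewrite /= in_itv/= => h1; rewrite frac_id.
apply: (etrans (lam_box (A := fun i => `[0, 1[%classic `&`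
    [set x : R | Num.floor (2 ^+ p * frac (x + w i)) = a i]) _)).
  by move=> i; apply: measurableI; [exact: measurable_itv|exact:
    (measurable_addr_preimage (w i) (mS1 i))].
apply: (etrans _ (esym (lam_box (A := fun i => `[0, 1[%classic `&`
    [set x : R | Num.floor (2 ^+ p * frac x) = a i]) _))); last first.
  by move=> i; apply: measurableI; [exact: measurable_itv|exact: mS1].
apply: eq_bigr => i _.
apply: (circle_shift (S := [set x | Num.floor (2 ^+ p * frac x) = a i])) => //.
by move=> x b /=; rewrite frac_addz.
Qed.

(** Double counting: Tonelli's theorem for the indicator of [A], both iterated integrals being those
    of constants. *)
Lemma constant_sections d1 d2 (T1 : measurableType d1) (T2 : measurableType d2)
    (m1 : {sigma_finite_measure set T1 -> \bar R})
    (m2 : {sigma_finite_measure set T2 -> \bar R})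
    (D1 : set T1) (D2 : set T2) (A : set (T1 * T2)) (v1 v2 : \bar R) :
  measurable D1 -> measurable D2 -> measurable A -> A `<=` D1 `*` D2 ->
  (0 <= v1)%E -> (0 <= v2)%E ->
  (forall x, D1 x -> m2 (xsection A x) = v2) ->
  (forall y, D2 y -> m1 (ysection A y) = v1) ->
  (v2 * m1 D1 = v1 * m2 D2)%E.
Proof.
move=> mD1 mD2 mA AD v10 v20 h2 h1.
have := indic_fubini_tonelli m1 m2 mA.
rewrite indic_fubini_tonelli_FE// indic_fubini_tonelli_GE//=.
rewrite (eq_integral (fun c => cst v2 c * (\1_D1 c)%:E)%E); last first.
  move=> c _; rewrite indicE /cst; have [h|h] := boolP (c \in D1).
    by rewrite mule1 /= h2//; rewrite inE in h.
  rewrite mule0 /= (_ : xsection _ _ = set0) ?measure0//.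
  apply/seteqP; split => y //; rewrite xsectionE /= => /AD[/=].
  by rewrite notin_setE in h.
rewrite (eq_integral (fun c => cst v1 c * (\1_D2 c)%:E)%E); last first.
  move=> c _; rewrite indicE /cst; have [h|h] := boolP (c \in D2).
    by rewrite mule1 /= h1//; rewrite inE in h.
  rewrite mule0 /= (_ : ysection _ _ = set0) ?measure0//.
  apply/seteqP; split => y //; rewrite ysectionE /= => /AD[/= _].
  by rewrite notin_setE in h.
rewrite !ge0_integralZl//; try exact/measurable_EFinP/measurable_indic.
by rewrite !integral_indic// !setIT.
Qed.

(* [S] has the same probability as each of its translates, hence as their
   average over [c]; this computes probabilities of events defined by integer
   linear forms. *)
Lemma averaging k l k' l' (S : set (space R k l))
    (w : space R k' l' -> 'I_k + 'I_l -> R) (v : \bar R) :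
  measurable S -> periodic S ->
  (forall i, measurable_fun setT (fun c => w c i : measurableTypeR R)) ->
  (forall x, lam R k' l' (ucube k' l' `&` [set c | S (shift x (w c))]) = v) ->
  lam R k l (ucube k l `&` S) = v.
Proof.
move=> mS pS mw hv.
pose A : set (space R k' l' * space R k l) := 
  [set cx | ucube k' l' cx.1 /\ ucube k l cx.2 /\ S (shift cx.2 (w cx.1))].
have mA : measurable A.
  apply: measurableI.
    by rewrite -[X in measurable X]setTI; apply: measurable_fst => //;
      exact: measurable_ucube.
  apply: measurableI.
    by rewrite -[X in measurable X]setTI; apply: measurable_snd => //;
      exact: measurable_ucube.
  have mg : measurable_fun setT (fun cx : space R k' l' * space R k l => shift
    cx.2 (w cx.1)).
    apply: measurable_fun_coord => i.
    rewrite (_ : (fun _ => _) = fun cx : space R k' l' * space R k l => coord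
      cx.2 i + w cx.1 i).
      apply: measurable_funD.
        by apply: (measurableT_comp (measurable_coord i));
          exact: measurable_snd.
      by apply: (measurableT_comp (mw i)); exact: measurable_fst.
    by apply/funext => z; rewrite coordK.
  by rewrite -[X in measurable X]setTI; exact: mg.
set x := lam R k l _.
suff : (x * lam R k' l' (ucube k' l') = v * lam R k l (ucube k l))%E.
  by rewrite !lam_ucube !mule1.
apply: (constant_sections (A := A)).
- exact: measurable_ucube.
- exact: measurable_ucube.
- exact: mA.
- by move=> [c y] [? [? ?]].
- by rewrite -(hv (of_coord (fun=> 0))); exact: measure_ge0.
- exact: measure_ge0.
- move=> c hc; rewrite /x -(torus_shift (w c))//; congr (lam _ _ _ _).
  by apply/seteqP; split => y; rewrite xsectionE /=; [move=> [_]|].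
- move=> y hy; rewrite -(hv y); congr (lam _ _ _ _).
  by apply/seteqP; split => c; rewrite ysectionE /=; [move=> [? []]|move=> []].
Qed.

Definition dilate k l (p : nat) (z : space R k l) : space R k l :=
  of_coord (fun i => 2 ^+ p * coord z i).

Lemma measurable_dilate k l p : measurable_fun setT (@dilate k l p).
Proof.
apply: measurable_fun_coord => i.
rewrite (_ : (fun _ => _) = fun z : space R k l => 2 ^+ p * coord z i).
  by apply: measurable_funM => //; exact: measurable_coord.
by apply/funext => z; rewrite coordK.
Qed.

Lemma lam_dilate k l p (A : set (space R k l)) : measurable A ->
  lam R k l (dilate p @^-1` A) = (((2 ^- p) ^+ (k + l))%:E * lam R k l A)%E.
Proof.
have c0 : 0 <= (2 ^- p) ^+ (k + l) :> R by rewrite exprn_ge0// invr_ge0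
  exprn_ge0.
have -> : ((2 ^- p) ^+ (k + l))%:E = (NngNum c0)%:num%:E :> \bar R by [].
apply: (dyadic_unique_image (m2 := mscale (NngNum c0) (lam R k l))).
- exact: measurable_dilate.
- move=> q a; rewrite /= /mscale/= lam_dcube/=.
  rewrite (_ : _ @^-1` _ = dcube (q + p) a).
    by rewrite lam_dcube -EFinM -exprMn -invfM -exprD [(p + q)%N]addnC.
  by apply/seteqP; split => z h i; have := h i; rewrite coordK mulrA -exprD.
- by move=> a; rewrite /= /mscale/= lam_dcube -EFinM ltry.
Qed.

End torus.
Arguments ucube : clear implicits.

(** * Probabilities on the torus *)

Section torus_probability.
Context {R : realType}.

Lemma lam_ucube_fin_num k l (A : set (space R k l)) : measurable A ->
  lam R k l (ucube R k l `&` A) \is a fin_num.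
Proof.
move=> mA; rewrite ge0_fin_numE ?measure_ge0//.
apply: le_lt_trans (_ : lam R k l (ucube R k l) < _)%E.
  apply: le_measure; rewrite ?inE//; last exact: measurable_ucube.
  by apply: measurableI => //; exact: measurable_ucube.
by rewrite lam_ucube ltry.
Qed.

Definition torus_prob k l (A : set (space R k l)) : R :=
  fine (lam R k l (ucube R k l `&` A)).

Local Notation P := torus_prob.

Lemma torus_probE k l (A : set (space R k l)) : measurable A ->
  lam R k l (ucube R k l `&` A) = (P A)%:E.
Proof. by move=> mA; rewrite /torus_prob fineK//; exact: lam_ucube_fin_num. Qed.

Lemma torus_prob_ge0 k l (A : set (space R k l)) : 0 <= P A.
Proof. by rewrite fine_ge0// measure_ge0. Qed.

Lemma le_torus_prob k l (A B : set (space R k l)) : measurable A -> measurable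
  B ->
  A `<=` B -> P A <= P B.
Proof.
move=> mA mB AB; rewrite -lee_fin -!torus_probE//.
apply: le_measure; rewrite ?inE; try by apply: measurableI => //;
  exact: measurable_ucube.
exact: setIS.
Qed.

Lemma torus_probT k l : P [set: space R k l] = 1.
Proof. by rewrite /torus_prob setIT lam_ucube. Qed.

Lemma torus_probC k l (A : set (space R k l)) : measurable A -> P (~` A) = 1 -
  P A.
Proof.
move=> mA; apply/eqP; rewrite eq_sym subr_eq addrC; apply/eqP.
apply: EFin_inj; rewrite EFinD -!torus_probE//; last exact: measurableC.
rewrite -measureU.
- by rewrite -setIUr setUv setIT; exact/esym/lam_ucube.
- by apply: measurableI => //; exact: measurable_ucube.
- by apply: measurableI; [exact: measurable_ucube|exact: measurableC].
- by rewrite setIACA setICr setI0.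
Qed.

Lemma torus_prob_averaging k l k' l' (S : set (space R k l))
    (w : space R k' l' -> 'I_k + 'I_l -> R) (v : R) :
  measurable S -> periodic S ->
  (forall i, measurable_fun setT (fun c => w c i : measurableTypeR R)) ->
  (forall x, lam R k' l' (ucube R k' l' `&` [set c | S (shift x (w c))]) =
    v%:E) ->
  P S = v.
Proof.
by move=> mS pS mw h; rewrite /torus_prob (averaging mS pS mw h).
Qed.

(* Integrating [2 t N <= N ^ 2 + t ^ 2 1_{N > 0}], where [N] counts the events
   that occur, and optimizing over [t], avoids the Cauchy-Schwarz inequality. *)
Lemma chung_erdos k l (I : finType) (J : {pred I}) (S : I -> set (space R k l))
    (U : set (space R k l)) (s e : R) :
  (forall i, measurable (S i)) -> measurable U -> (forall i, i \in J -> S i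
    `<=` U) ->
  s <= \sum_(i in J) P (S i) -> \sum_(i in J) \sum_(j in J) P (S i `&` S j) <=
    e ->
  0 < s -> 0 < e -> s ^+ 2 / e <= P U.
Proof.
move=> mS mU SU; set J' := enum J.
have EJ (F : I -> R) : \sum_(i in J) F i = \sum_(i <- J') F i by rewrite
  big_enum.
rewrite !EJ => hs; under eq_bigr do rewrite EJ.
move=> he s0 e0.
suff key (t : R) : 0 <= t -> 2 * t * (\sum_(i <- J') P (S i)) <=
    \sum_(i <- J') \sum_(j <- J') P (S i `&` S j) + t ^+ 2 * P U.
  have /key : 0 <= e / s by rewrite divr_ge0// ltW.
  move=> h; have {}h : 2 * (e / s) * s <= e + (e / s) ^+ 2 * P U.
    apply: le_trans (le_trans h _); last by rewrite lerD2r.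
    by rewrite ler_pM2l ?mulr_gt0// ?invr_gt0.
  rewrite ler_pdivrMr//.
  have {}h : e <= (e / s) ^+ 2 * P U.
    have E : 2 * (e / s) * s = 2 * e by field; rewrite gt_eqF.
    by rewrite E in h; lra.
  have : e * (s ^+ 2) <= (e / s) ^+ 2 * P U * s ^+ 2 by rewrite ler_pM2r
    ?exprn_gt0.
  have -> : (e / s) ^+ 2 * P U * s ^+ 2 = e * (P U * e) by field;
    rewrite gt_eqF.
  by rewrite ler_pM2l.
move=> t0.
pose Q := ucube R k l.
have mQ : measurable Q by exact: measurable_ucube.
have PE A : measurable A -> lam R k l (Q `&` A) = (P A)%:E by exact:
  torus_probE.
have mQS i : measurable (Q `&` S i) by exact: measurableI.
have mQSS i j : measurable (Q `&` (S i `&` S j)) by do 2 apply: measurableI =>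
  //.
have mQU : measurable (Q `&` U) by exact: measurableI.
pose f z : R := \sum_(i <- J') 2 * t * \1_(Q `&` S i) z.
pose g z : R := \sum_(i <- J') \sum_(j <- J') \1_(Q `&` (S i `&` S j)) z
  + t ^+ 2 * \1_(Q `&` U) z.
have fg z : f z <= g z.
  pose N : R := \sum_(i <- J') \1_(Q `&` S i) z.
  have fE : f z = 2 * t * N by rewrite /f -mulr_sumr.
  have gE : g z = N ^+ 2 + t ^+ 2 * \1_(Q `&` U) z.
    rewrite /g; congr (_ + _); rewrite expr2 /N mulr_suml;
      apply: eq_bigr => i _.
    rewrite mulr_sumr; apply: eq_bigr => j _.
    by rewrite -[RHS]/((\1_(Q `&` S i) \* \1_(Q `&` S j)) z) -indicI setIACA
      setIid.
  rewrite fE gE indicE; case: (boolP (z \in _)) => [_|h].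
    by have := sqr_ge0 (N - t); rewrite mulr1 => h; nra.
  suff -> : N = 0 by rewrite !mulr0 expr0n/= addr0.
  rewrite /N big1_seq// => i /=; rewrite mem_enum => iJ; rewrite indicE;
    case: (boolP (z \in _)) => // zi.
  by move: h; rewrite !inE in zi *; rewrite notin_setE => -[]; split;
    [case: zi|apply: SU iJ _ _; case: zi].
have If : (\int[lam R k l]_z (f z)%:E = (2 * t * \sum_(i <- J') P (S i))%:E)%E.
  under eq_integral do rewrite /f -sumEFin.
  rewrite ge0_integral_sum//; last 2 first.
  - by move=> i; apply/measurable_EFinP; apply: measurable_funM => //;
    exact: measurable_indic.
  - by move=> i z _; rewrite lee_fin mulr_ge0 ?mulr_ge0.
  rewrite mulr_sumr -sumEFin; apply: eq_bigr => i _.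
  under eq_integral do rewrite EFinM.
  rewrite ge0_integralZl//; [|exact/measurable_EFinP/measurable_indic|by
    rewrite lee_fin mulr_ge0].
  by rewrite integral_indic// setIT /= PE// EFinM.
have Ig : (\int[lam R k l]_z (g z)%:E = (\sum_(i <- J') \sum_(j <- J') P (S i
  `&` S j)
    + t ^+ 2 * P U)%:E)%E.
  under eq_integral do rewrite /g EFinD -sumEFin.
  rewrite ge0_integralD//; last 4 first.
  - by move=> z _; rewrite sumEFin lee_fin; apply: sumr_ge0 => i _;
    apply: sumr_ge0.
  - under eq_fun do rewrite sumEFin; apply/measurable_EFinP.
    apply: measurable_sum => i; apply: measurable_sum => j;
      exact: measurable_indic.
  - by move=> z _; rewrite lee_fin mulr_ge0// sqr_ge0.
  - by apply/measurable_EFinP; apply: measurable_funM => //;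
    exact: measurable_indic.
  rewrite EFinD; congr (_ + _)%E.
    rewrite ge0_integral_sum//; last 2 first.
    - move=> i; apply/measurable_EFinP; apply: measurable_sum => j;
      exact: measurable_indic.
    - by move=> i z _; rewrite lee_fin; apply: sumr_ge0.
    rewrite -sumEFin; apply: eq_bigr => i _.
    under eq_integral do rewrite -sumEFin.
    rewrite ge0_integral_sum//; last first.
      by move=> j; apply/measurable_EFinP; exact: measurable_indic.
    rewrite -sumEFin; apply: eq_bigr => j _.
    by rewrite integral_indic// setIT /= PE//; exact: measurableI.
  under eq_integral do rewrite EFinM.
  rewrite ge0_integralZl//; [|exact/measurable_EFinP/measurable_indic|by
    rewrite lee_fin sqr_ge0].
  by rewrite integral_indic// setIT /= PE// EFinM.
rewrite -lee_fin -If -Ig; apply: ge0_le_integral => //.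
- by move=> z _; rewrite lee_fin; apply: sumr_ge0 => i _;
  rewrite mulr_ge0 ?mulr_ge0.
- apply/measurable_EFinP; apply: measurable_sum => i.
  by apply: measurable_funM => //; exact: measurable_indic.
- apply/measurable_EFinP; apply: measurable_funD.
    apply: measurable_sum => i; apply: measurable_sum => j;
      exact: measurable_indic.
  by apply: measurable_funM => //; exact: measurable_indic.
- by move=> z _; rewrite lee_fin.
Qed.

End torus_probability.

(** * A zero-one law *)

Section zero_one.
Context {R : realType}.
Local Notation P := torus_prob.

Lemma space_ext k l (z z' : space R k l) :
  (forall i, coord z i = coord z' i) -> z = z'.
Proof.
case: z z' => [t1 t2] [t1' t2'] h; congr (_, _); apply: eq_from_tnth => i.
  exact: (h (inl i)).
exact: (h (inr i)).
Qed.

Lemma dcube0_shift k l (a : {ffun 'I_k + 'I_l -> int}) :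
  [set z | dcube 0 a (shift z (fun i => (a i)%:~R))] = ucube R k l.
Proof.
rewrite ucubeE; apply/seteqP; split => z h i; have := h i.
  rewrite coordK ffunE !expr0 !mul1r => /eqP; rewrite floor_eq intrD => h'.
  by apply/eqP; rewrite floor_eq; lra.
rewrite coordK ffunE !expr0 !mul1r => /eqP; rewrite floor_eq => h'.
by apply/eqP; rewrite floor_eq intrD; lra.
Qed.

Lemma lam_dcube0_periodic k l (S : set (space R k l)) (a : {ffun 'I_k + 'I_l ->
  int}) :
  measurable S -> periodic S -> lam R k l (dcube 0 a `&` S) = (P S)%:E.
Proof.
move=> mS pS; rewrite -torus_probE// -(lam_shift (fun i => (a i)%:~R));
  last first.
  by apply: measurableI => //; exact: measurable_dcube.
rewrite -[in RHS](dcube0_shift a); congr (lam _ _ _ _); apply/seteqP.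
by split => z [h1 h2]; split => //; exact/(pS z a).
Qed.

Lemma negligible_periodic k l (S : set (space R k l)) :
  measurable S -> periodic S -> P S = 0 -> (lam R k l).-negligible S.
Proof.
move=> mS pS S0; rewrite -(setTI S) -bigcup_dcube setI_bigcupl.
apply: negligible_bigcup => n; case: unpickle => [a|]; last first.
  by rewrite set0I; exact: negligible_set0.
exists (dcube 0 a `&` S); split => //; last by rewrite /= lam_dcube0_periodic//
  S0.
by apply: measurableI => //; exact: measurable_dcube.
Qed.

(** Average over the translations by [2 ^- p * c]: after dilation they become the translations by
    [c], under which the probability of [S] is known. *)
Lemma torus_prob_dilate k l p (S : set (space R k l)) :
  measurable S -> periodic S -> P (dilate p @^-1` S) = P S.
Proof.
move=> mS pS.
pose w (c : space R k l) i := 2 ^- p * coord c i.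
have p0 : 2 ^+ p != 0 :> R by rewrite expf_neq0.
apply: (@torus_prob_averaging _ _ _ _ _ _ w).
- by rewrite -[X in measurable X]setTI; exact: measurable_dilate.
- move=> z a; rewrite -[X in _ <-> X]/(S (dilate p z)).
  rewrite -(pS (dilate p z) (fun i => 2 ^+ p * a i)) /=.
  suff -> : dilate p (shift z (fun i => (a i)%:~R)) =
            shift (dilate p z) (fun i => (2 ^+ p * a i)%:~R) by [].
  by apply: space_ext => i; rewrite !coordK mulrDr intrM rmorphXn.
- by move=> i; apply: measurable_funM => //; exact: measurable_coord.
- move=> x; rewrite -torus_probE// -[in RHS](torus_shift (coord (dilate p
  x)))//.
  have E c : dilate p (shift x (w c)) = shift c (coord (dilate p x)).
    by apply: space_ext => i; rewrite !coordK mulrDr /w mulVKf// addrC.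
  congr (lam _ _ _ _); congr (_ `&` _); apply/seteqP; split => c h.
    by change (S (shift c (coord (dilate p x)))); rewrite -E.
  by change (S (dilate p (shift x (w c)))); rewrite E.
Qed.

(* [S] and its preimage under [dilate p] differ by a null set, and the preimage
   has the same density in every dyadic cube of side [2 ^- p].  So [S] is
   independent of all dyadic cubes, hence of itself. *)
Lemma zero_one k l (S : set (space R k l)) : measurable S -> periodic S ->
  (forall z, S z -> S (dilate 1 z)) -> P S < 1 -> P S = 0.
Proof.
move=> mS pS dS S1.
have dSp p z : S z -> S (dilate p z).
  elim: p => [|p ih] in z *; move=> Sz.
    suff -> : dilate 0 z = z by [].
    by apply: space_ext => i; rewrite coordK expr0 mul1r.
  suff -> : dilate p.+1 z = dilate 1 (dilate p z) by exact/dS/ih.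
  by apply: space_ext => i; rewrite !coordK expr1 exprS mulrA.
have mQ : measurable (ucube R k l) by exact: measurable_ucube.
have mdS p : measurable (dilate p @^-1` S).
  by rewrite -[X in measurable X]setTI; exact: measurable_dilate.
(* [S] lies in its preimage and has the same probability, so the difference is null. *)
have null p : lam R k l (ucube R k l `&` (dilate p @^-1` S `\` S)) = 0%E.
  have mD : measurable (dilate p @^-1` S `\` S) by exact: measurableD.
  have : (lam R k l (ucube R k l `&` S) + lam R k l (ucube R k l `&` (dilate p
    @^-1` S `\` S)) =
      lam R k l (ucube R k l `&` S))%E.
    rewrite -measureU; [|exact: measurableI|exact: measurableI|]; last first.
      by rewrite setIACA setIDA (setIC S) -setIDA setDv !setI0.
    rewrite -setIUr setDUK; last by move=> z; exact: dSp.
    by rewrite /= !torus_probE// torus_prob_dilate.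
  rewrite !torus_probE// -EFinD => -[] h.
  by congr (_%:E); lra.
have S0 : 0 <= P S by exact: torus_prob_ge0.
have mSQ : measurable (S `&` ucube R k l) by exact: measurableI.
(* Independence is phrased as the equality of two measures, checked on dyadic cubes; at [S] itself
   it reads [P S = P S * P S]. *)
pose m1 := mrestr (lam R k l) mSQ.
pose m2 := mscale (NngNum S0) (mrestr (lam R k l) mQ).
have : m1 S = m2 S.
  apply: dyadic_unique => //; last first.
    move=> a; rewrite /m1 /= /mrestr.
    apply: le_lt_trans (_ : lam R k l (dcube 0 a) < _)%E;
      last by rewrite lam_dcube ltry.
    apply: le_measure; rewrite ?inE//; last exact: measurable_dcube.
    by apply: measurableI => //; exact: measurable_dcube.
  move=> p a; rewrite /m1 /m2 /= /mrestr /mscale/= /mrestr.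
  have [[z [za zQ]]|h] := pselect (exists z, dcube p a z /\ ucube R k l z);
    last first.
    have dQ0 : dcube p a `&` ucube R k l = set0.
      by apply/seteqP; split => // z [? ?]; apply: h; exists z.
    by rewrite dQ0 (setIC S) setIA dQ0 set0I !measure0 mule0.
  have dQ : dcube p a `<=` ucube R k l.
    rewrite ucubeE in zQ *; move=> y ya i; rewrite -zQ.
    by apply: floor_dyadic_coarsen (leq0n p) _; rewrite ya za.
  rewrite (setIC S) setIA (setIidl dQ) lam_dcube.
  have -> : lam R k l (dcube p a `&` S) = lam R k l (dcube p a `&` dilate p
    @^-1` S).
    have mc := @measurable_dcube R k l p a.
    rewrite -[in RHS](@setDUK _ S (dilate p @^-1` S)); last by move=> y;
      exact: dSp.
    rewrite setIUr measureU; [|exact: measurableI|by apply: measurableI => //;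
      exact: measurableD|].
      rewrite [X in (_ + X)%E](_ : _ = 0%E) ?adde0//.
      apply/eqP; rewrite eq_le measure_ge0 andbT /= -(null p).
      apply: le_measure; rewrite ?inE; [|by apply: measurableI => //;
        exact: measurableD|exact: setSI].
      by apply: measurableI => //; exact: measurableD.
    by rewrite setIACA setIDA (setIC S) -setIDA setDv !setI0.
  rewrite (_ : _ `&` _ = dilate p @^-1` (dcube 0 a `&` S)).
    rewrite lam_dilate; last by apply: measurableI => //;
      exact: measurable_dcube.
    by rewrite lam_dcube0_periodic// muleC.
  rewrite preimage_setI; congr (_ `&` _); apply/seteqP; split => y h i;
    have := h i;
    by rewrite coordK expr0 mul1r.
rewrite /m1 /m2 /= /mrestr /mscale/= /mrestr setIA setIid setIC torus_probE//
  -EFinM => -[].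
move=> /eqP; rewrite -[X in X == _]mulr1 -subr_eq0 -mulrBr mulf_eq0 =>
  /orP[/eqP//|].
by rewrite subr_eq0 eq_sym lt_eqF.
Qed.

Lemma torus_prob_bigcup_le k l (S : (set (space R k l))^nat) (c : R) :
  (forall n, measurable (S n)) -> (forall n, S n `<=` S n.+1) ->
  (forall n, P (S n) <= c) -> P (\bigcup_n S n) <= c.
Proof.
move=> mS ndS Sc.
have mU : measurable (\bigcup_n S n) by exact: bigcupT_measurable.
have mQ := @measurable_ucube R k l.
rewrite -lee_fin -torus_probE// setI_bigcupr.
have := @nondecreasing_cvg_mu _ _ _ (lam R k l) (fun n => ucube R k l `&` S n).
move=> /(_ (fun n => measurableI _ _ mQ (mS n))).
rewrite -setI_bigcupr => /(_ (measurableI _ _ mQ mU)).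
have nd : nondecreasing_seq (fun n => ucube R k l `&` S n).
  by apply/nondecreasing_seqP => n; apply/subsetPset; exact: setIS.
move=> /(_ nd) h; rewrite -(cvg_lim _ h)//.
apply: lime_le; first by apply: cvgP h.
by apply: nearW => n; rewrite /= torus_probE// lee_fin.
Qed.

Lemma torus_borel_cantelli k l (F : (set (space R k l))^nat) (e : nat -> R) (M
  : R) :
  (forall n, measurable (F n)) -> (forall n, P (F n) <= e n) ->
  (forall N, \sum_(0 <= n < N) e n <= M) ->
  P (\bigcap_n \bigcup_(j in [set j | (n <= j)%N]) F j) = 0.
Proof.
move=> mF Fe eM.
have mQ := @measurable_ucube R k l.
have h : mrestr (lam R k l) mQ (lim_sup_set F) = 0%E; last first.
  by rewrite /torus_prob setIC; move: h; rewrite /mrestr => ->.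
apply: lim_sup_set_cvg0 => //.
apply: le_lt_trans (ltry M).
apply: lime_le; first exact: is_cvg_nneseries.
apply: nearW => N; rewrite /=.
rewrite (eq_bigr (fun n => (P (F n))%:E)); last by move=> n _;
  rewrite /mrestr setIC torus_probE.
by rewrite sumEFin lee_fin; apply: le_trans (eM N); apply: ler_sum.
Qed.

End zero_one.

(** * Linear forms *)

Section linear_forms.
Context {R : realType}.
Local Notation P := torus_prob.
Local Notation mu := (@lebesgue_measure R).

Definition near_int (r : R) : set R := [set x | exists p : int, `|x - p%:~R| <
  r].

Lemma measurable_near_int r : measurable (near_int r : set (measurableTypeR R)).
Proof.
rewrite (_ : near_int r = \bigcup_(p in [set: int]) `]p%:~R - r, p%:~R +
  r[%classic).
  apply: countable_bigcupT_measurable; first exact: countableP.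
  by move=> p; exact: measurable_itv.
apply/seteqP; split => x.
  by move=> [p hp]; exists p => //=; rewrite in_itv/= -ltr_distl.
by move=> [p _ /=]; rewrite in_itv/= -ltr_distl => ?; exists p.
Qed.

Lemma periodic1_near_int r : periodic1 (near_int r).
Proof.
move=> x a; split=> -[p hp].
  by exists (p - a); rewrite intrB opprB addrA.
by exists (p + a); rewrite intrD opprD addrACA subrr addr0.
Qed.

Lemma circle_near_int r : 0 < r -> r <= 2^-1 ->
  mu (`[0, 1[%classic `&` near_int r) = (2 * r)%:E.
Proof.
move=> r0 r2; rewrite (_ : _ `&` _ = `[0, r[ `|` `]1 - r, 1[).
  rewrite measureU.
  - rewrite /= !lebesgue_measure_itv/= !lte_fin r0 ifT; last by lra.
    by rewrite -!EFinB -EFinD; congr EFin; lra.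
  - exact: measurable_itv.
  - exact: measurable_itv.
  - by apply/seteqP; split => // x [] /=; rewrite !in_itv/=; lra.
apply/seteqP; split => x /=; rewrite !in_itv/=.
  move=> [/andP[x0 x1] [p]]; rewrite ltr_distl => /andP[h1 h2].
  have p2 : p%:~R < 2 :> R by lra.
  have p1 : -1 < p%:~R :> R by lra.
  have {p1 p2} : p = 0 \/ p = 1.
    move: p1 p2; rewrite -[-1]/((-1)%:~R) -[2]/(2%:~R) !ltr_int.
    by clear; lia.
  by move=> [?|?]; subst p; [left|right]; rewrite ?mulr0z ?mulr1z in h1 h2; lra.
move=> [h|h]; (split; first lra).
  by exists 0; rewrite subr0 ger0_norm; lra.
by exists 1; rewrite ltr0_norm; lra.
Qed.

Lemma circle_not_near_int :
  mu (`[0, 1[%classic `&` ~` near_int (4^-1)) = (2^-1)%:E.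
Proof.
rewrite -setDE measureD/=.
- rewrite circle_near_int; [|lra|lra].
  by rewrite lebesgue_measure_itv/= lte_fin ltr01 -!EFinB; congr EFin; lra.
- exact: measurable_itv.
- exact: measurable_near_int.
- by rewrite lebesgue_measure_itv/= lte_fin ltr01 -!EFinB ltry.
Qed.

Lemma lam_ucube_box k l (B : 'I_k + 'I_l -> set R) (b y : 'I_k + 'I_l -> R) :
  (forall i, measurable (B i : set (measurableTypeR R))) ->
  (forall i, periodic1 (B i)) ->
  (forall i, mu (`[0, 1[%classic `&` B i) = (b i)%:E) ->
  lam R k l (ucube R k l `&` [set c | forall i, B i (coord c i + y i)]) =
  (\prod_i b i)%:E.
Proof.
move=> mB pB Bb.
rewrite (_ : _ `&` _ = [set c | forall i,
   (`[0, 1[%classic `&` [set t | B i (t + y i)]) (coord c i)]); last first.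
  apply/seteqP; split => c.
    by move=> [h1 h2] i; split; [rewrite /= in_itv/=; exact: h1|exact: h2].
  by move=> h; split => i; have [] := h i; rewrite //= in_itv.
apply: (etrans (lam_box (A := fun i => `[0, 1[%classic `&` [set t | B i (t + y
  i)]) _)).
  move=> i; apply: measurableI; first exact: measurable_itv.
  exact: (measurable_addr_preimage (y i) (mB i)).
rewrite -prode_EFin; apply: eq_bigr => i _.
by rewrite circle_shift.
Qed.

Variables m n : nat.
Implicit Types z : space R (m * n) m.

(** With [z] encoding [(A, b)], these are the coordinates of [A q + b]; [col_form] gives those of
    [A^T u], and [vec_form] is [u . b]. *)
Definition row_form z (q : 'I_n -> int) (i : 'I_m) : R :=
  \sum_j coord z (inl (mxvec_index i j)) * (q j)%:~R + coord z (inr i).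

Definition col_form z (u : 'I_m -> int) (j : 'I_n) : R :=
  \sum_i coord z (inl (mxvec_index i j)) * (u i)%:~R.

Definition vec_form z (u : 'I_m -> int) : R := \sum_i coord z (inr i) * (u
  i)%:~R.

Lemma measurable_row_form q i : measurable_fun setT
  (fun z => row_form z q i : measurableTypeR R).
Proof.
apply: measurable_funD; last exact: measurable_coord.
by apply: measurable_sum => j; apply: measurable_funM => //;
  exact: measurable_coord.
Qed.

Lemma measurable_col_form u j : measurable_fun setT
  (fun z => col_form z u j : measurableTypeR R).
Proof.
by apply: measurable_sum => i; apply: measurable_funM => //;
  exact: measurable_coord.
Qed.

Lemma measurable_vec_form u : measurable_fun setT
  (fun z => vec_form z u : measurableTypeR R).
Proof.
by apply: measurable_sum => i; apply: measurable_funM => //;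
  exact: measurable_coord.
Qed.

Lemma row_form_shift z f q i : row_form (shift z f) q i =
  row_form z q i + (\sum_j f (inl (mxvec_index i j)) * (q j)%:~R + f (inr i)).
Proof.
rewrite /row_form coordK addrACA; congr (_ + _); rewrite -big_split.
by apply: eq_bigr => j _; rewrite coordK mulrDl.
Qed.

Lemma col_form_shift z f u j : col_form (shift z f) u j =
  col_form z u j + \sum_i f (inl (mxvec_index i j)) * (u i)%:~R.
Proof.
rewrite /col_form -big_split.
by apply: eq_bigr => i _; rewrite coordK mulrDl.
Qed.

Lemma vec_form_shift z f u : vec_form (shift z f) u =
  vec_form z u + \sum_i f (inr i) * (u i)%:~R.
Proof.
rewrite /vec_form -big_split.
by apply: eq_bigr => i _; rewrite coordK mulrDl.
Qed.

Lemma row_form_shiftz z (a : 'I_(m * n) + 'I_m -> int) q i :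
  row_form (shift z (fun i => (a i)%:~R)) q i = row_form z q i +
    (\sum_j a (inl (mxvec_index i j)) * q j + a (inr i))%:~R.
Proof.
rewrite row_form_shift intrD (raddf_sum (intmul 1))/=; congr (_ + (_ + _)).
by apply: eq_bigr => j _; rewrite intrM.
Qed.

Lemma col_form_shiftz z (a : 'I_(m * n) + 'I_m -> int) u j :
  col_form (shift z (fun i => (a i)%:~R)) u j = col_form z u j +
    (\sum_i a (inl (mxvec_index i j)) * u i)%:~R.
Proof.
rewrite col_form_shift (raddf_sum (intmul 1))/=; congr (_ + _).
by apply: eq_bigr => i _; rewrite intrM.
Qed.

Lemma vec_form_shiftz z (a : 'I_(m * n) + 'I_m -> int) u :
  vec_form (shift z (fun i => (a i)%:~R)) u = vec_form z u +
    (\sum_i a (inr i) * u i)%:~R.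
Proof.
rewrite vec_form_shift (raddf_sum (intmul 1))/=; congr (_ + _).
by apply: eq_bigr => i _; rewrite intrM.
Qed.

Definition row_event (B : set R) (q : 'I_n -> int) : set (space R (m * n) m) :=
  [set z | forall i, B (row_form z q i)].

Definition col_event (B : set R) (u : 'I_m -> int) : set (space R (m * n) m) :=
  [set z | forall j, B (col_form z u j)].

Definition vec_event (B : set R) (u : 'I_m -> int) : set (space R (m * n) m) :=
  [set z | B (vec_form z u)].

Lemma measurable_row_event B q : measurable (B : set (measurableTypeR R)) ->
  measurable (row_event B q).
Proof.
move=> mB; apply: measurable_forall => i; rewrite -[X in measurable X]setTI.
exact: measurable_row_form.
Qed.

Lemma measurable_col_event B u : measurable (B : set (measurableTypeR R)) ->
  measurable (col_event B u).
Proof.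
move=> mB; apply: measurable_forall => i; rewrite -[X in measurable X]setTI.
exact: measurable_col_form.
Qed.

Lemma measurable_vec_event B u : measurable (B : set (measurableTypeR R)) ->
  measurable (vec_event B u).
Proof.
by move=> mB; rewrite -[X in measurable X]setTI; exact: measurable_vec_form.
Qed.

Lemma periodic_row_event B q : periodic1 B -> periodic (row_event B q).
Proof.
by move=> pB z a; split => h i; have := h i; rewrite row_form_shiftz => /pB.
Qed.

Lemma periodic_col_event B u : periodic1 B -> periodic (col_event B u).
Proof.
by move=> pB z a; split => h i; have := h i; rewrite col_form_shiftz => /pB.
Qed.

Lemma periodic_vec_event B u : periodic1 B -> periodic (vec_event B u).
Proof.
by move=> pB z a; split; rewrite /vec_event/= vec_form_shiftz => /pB.
Qed.

Lemma periodicI k l (A B : set (space R k l)) :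
  periodic A -> periodic B -> periodic (A `&` B).
Proof.
by move=> pA pB z a; split => -[h1 h2]; split; [exact/(pA z a)|exact/(pB z a)|
  exact/(pA z a)|exact/(pB z a)].
Qed.

Definition mx_shift (M : 'M[R]_(m, n)) (d : 'I_m -> R) (i : 'I_(m * n) + 'I_m)
  : R :=
  match i with inl k => mxvec M 0 k | inr i => d i end.

Lemma measurable_mx_shift d0 (T : measurableType d0) (M : T -> 'M[R]_(m, n))
    (d : T -> 'I_m -> R) :
  (forall i j, measurable_fun setT (fun c => M c i j : measurableTypeR R)) ->
  (forall i, measurable_fun setT (fun c => d c i : measurableTypeR R)) ->
  forall i, measurable_fun setT (fun c => mx_shift (M c) (d c) i :
    measurableTypeR R).
Proof.
move=> mM md [k|i] //=; case/mxvec_indexP: k => i j.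
by under eq_fun do rewrite mxvecE; exact: mM.
Qed.

(** Translating [b] alone by a uniform vector already makes [A q + b] uniform. *)
Lemma prob_row_event B b q : measurable (B : set (measurableTypeR R)) ->
  periodic1 B -> mu (`[0, 1[%classic `&` B) = b%:E ->
  P (row_event B q) = b ^+ m.
Proof.
move=> mB pB Bb.
pose w (c : space R m 0) := mx_shift 0 (fun i => coord c (inl i)).
apply: (@torus_prob_averaging _ _ _ _ _ _ w).
- exact: measurable_row_event.
- exact: periodic_row_event.
- apply: measurable_mx_shift => [i j|i]; last exact: measurable_coord.
  by under eq_fun do rewrite mxE; exact: measurable_cst.
- move=> x.
  pose y (i : 'I_m + 'I_0) := if i is inl i then row_form x q i else 0.
  have := @lam_ucube_box m 0 (fun=> B) (fun=> b) y (fun=> mB) (fun=> pB) (fun=>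
    Bb).
  rewrite prodr_const card_sum !card_ord addn0 => <-.
  have E c i : row_form (shift x (w c)) q i = coord c (inl i) + row_form x q i.
    rewrite row_form_shift/= big1 ?add0r 1?addrC// => j _.
    by rewrite mxvecE mxE mul0r.
  congr (lam _ _ _ _); congr (_ `&` _); apply/seteqP; split => c h.
    by case=> [i|[]//]; rewrite /y -E; exact: h.
  by move=> i; rewrite E; exact: (h (inl i)).
Qed.

(** Only [b] and the column [j0] of [A], where [q] and [q'] differ, are translated. Solving for them
    makes [A q + b] and [A q' + b] move by two independent uniform vectors. The denominator [D] is
    harmless, since averaging allows arbitrary real translations. *)
Lemma prob_row_eventI B b q q' : measurable (B : set (measurableTypeR R)) ->
  periodic1 B -> mu (`[0, 1[%classic `&` B) = b%:E ->
  (exists j, q j != q' j) ->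
  P (row_event B q `&` row_event B q') = b ^+ m * b ^+ m.
Proof.
move=> mB pB Bb [j0 qq'].
pose D : R := (q' j0)%:~R - (q j0)%:~R.
have D0 : D != 0 by rewrite subr_eq0 eqr_int eq_sym.
pose w (c : space R m m) := mx_shift
  (\matrix_(i, j) if j == j0 then (coord c (inr i) - coord c (inl i)) / D else
    0)
  (fun i => coord c (inl i) - (q j0)%:~R * ((coord c (inr i) - coord c (inl i))
    / D)).
apply: (@torus_prob_averaging _ _ _ _ _ _ w).
- by apply: measurableI; exact: measurable_row_event.
- by apply: periodicI; exact: periodic_row_event.
- apply: measurable_mx_shift => [i j|i].
    under eq_fun do rewrite mxE; case: (j == j0); last exact: measurable_cst.
    apply: measurable_funM => //; apply: measurable_funB;
      exact: measurable_coord.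
  apply: measurable_funB; first exact: measurable_coord.
  do 2 apply: measurable_funM => //.
  apply: measurable_funB; exact: measurable_coord.
- move=> x.
  pose y (i : 'I_m + 'I_m) := match i with inl i => row_form x q i | inr i =>
    row_form x q' i end.
  have := @lam_ucube_box m m (fun=> B) (fun=> b) y (fun=> mB) (fun=> pB) (fun=>
    Bb).
  rewrite prodr_const card_sum !card_ord exprD => <-.
  have S c i (p : 'I_n -> int) : \sum_j w c (inl (mxvec_index i j)) * (p j)%:~R
    =
     (coord c (inr i) - coord c (inl i)) / D * (p j0)%:~R.
    rewrite (bigD1 j0)//= mxvecE mxE eqxx big1 ?addr0// => j /negbTE jj0.
    by rewrite mxvecE mxE jj0 mul0r.
  have E c i : row_form (shift x (w c)) q i = coord c (inl i) + row_form x q i.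
    by rewrite row_form_shift S /=; ring.
  have E' c i : row_form (shift x (w c)) q' i = coord c (inr i) + row_form x q'
    i.
    by rewrite row_form_shift S /= /D; field.
  congr (lam _ _ _ _); congr (_ `&` _); apply/seteqP; split => c.
    by move=> [h h'] [i|i]; rewrite /y; [rewrite -E; exact: h|rewrite -E';
      exact: h'].
  by move=> h; split => i; [rewrite E; exact: (h (inl i))|rewrite E';
    exact: (h (inr i))].
Qed.

(** Row [i0] of [A] and entry [i0] of [b] are translated; after division by [u i0] the forms [A^T u]
    and [u . b] move by the averaging variable itself. *)
Lemma prob_col_vec_event B b C c u : measurable (B : set (measurableTypeR R)) ->
  periodic1 B -> mu (`[0, 1[%classic `&` B) = b%:E ->
  measurable (C : set (measurableTypeR R)) ->
  periodic1 C -> mu (`[0, 1[%classic `&` C) = c%:E ->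
  (exists i, u i != 0) ->
  P (col_event B u `&` vec_event C u) = b ^+ n * c.
Proof.
move=> mB pB Bb mC pC Cc [i0 u0].
have D0 : (u i0)%:~R != 0 :> R by rewrite intr_eq0.
pose w (c : space R n 1) := mx_shift
  (\matrix_(i, j) if i == i0 then coord c (inl j) / (u i0)%:~R else 0)
  (fun i => if i == i0 then coord c (inr ord0) / (u i0)%:~R else 0).
apply: (@torus_prob_averaging _ _ _ _ _ _ w).
- by apply: measurableI; [exact: measurable_col_event|exact:
  measurable_vec_event].
- by apply: periodicI; [exact: periodic_col_event|exact: periodic_vec_event].
- apply: measurable_mx_shift => [i j|i].
    under eq_fun do rewrite mxE; case: (i == i0); last exact: measurable_cst.
    apply: measurable_funM => //; exact: measurable_coord.
  case: (i == i0); last exact: measurable_cst.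
  apply: measurable_funM => //; exact: measurable_coord.
- move=> x.
  pose y (i : 'I_n + 'I_1) := match i with inl j => col_form x u j | inr _ =>
    vec_form x u end.
  have h : lam R n 1 (ucube R n 1 `&` [set c | forall i,
      (match i with inl _ => B | inr _ => C end) (coord c i + y i)]) = (b ^+ n
        * c)%:E.
    rewrite (@lam_ucube_box n 1
      (fun i => match i with inl _ => B | inr _ => C end)
      (fun i => match i with inl _ => b | inr _ => c end) y); try by case.
    by rewrite big_sumType/= big_ord1 prodr_const card_ord.
  have E d j : col_form (shift x (w d)) u j = coord d (inl j) + col_form x u j.
    rewrite col_form_shift (bigD1 i0)//= mxvecE mxE eqxx mulfVK// big1 ?addr0
      1?addrC// => i /negbTE ii0.
    by rewrite mxvecE mxE ii0 mul0r.
  have E' d : vec_form (shift x (w d)) u = coord d (inr ord0) + vec_form x u.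
    rewrite vec_form_shift (bigD1 i0)//= eqxx mulfVK// big1 ?addr0 1?addrC// =>
      i /negbTE ii0.
    by rewrite ii0 mul0r.
  rewrite -h; congr (lam _ _ _ _); congr (_ `&` _); apply/seteqP; split => d.
    move=> [h1 h2] [i|i]; rewrite /y; [rewrite -E; exact: h1|].
    by rewrite (ord1 i) -E'; exact: h2.
  move=> h1; split; first by move=> j; rewrite E; exact: (h1 (inl j)).
  by rewrite /vec_event/= E'; exact: (h1 (inr ord0)).
Qed.

(** Cramer's rule on the rows [i0] and [i1], where [u] and [u'] have the nonzero minor [D], provides
    a translation of [A] that moves [A^T u] and [A^T u'] by independent uniform vectors. *)
Lemma prob_col_eventI B b B' b' u u' : measurable (B : set (measurableTypeR R))
  ->
  periodic1 B -> mu (`[0, 1[%classic `&` B) = b%:E ->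
  measurable (B' : set (measurableTypeR R)) ->
  periodic1 B' -> mu (`[0, 1[%classic `&` B') = b'%:E ->
  (exists i0 i1, u i0 * u' i1 != u i1 * u' i0) ->
  P (col_event B u `&` col_event B' u') = b ^+ n * b' ^+ n.
Proof.
move=> mB pB Bb mB' pB' Bb' [i0 [i1 uu']].
have i01 : i1 != i0 by apply/eqP => e; move: uu'; rewrite e eqxx.
pose D : R := (u i0)%:~R * (u' i1)%:~R - (u i1)%:~R * (u' i0)%:~R.
have D0 : D != 0 by rewrite subr_eq0 -!intrM eqr_int.
pose w (c : space R n n) := mx_shift
  (\matrix_(i, j)
    if i == i0 then
      (coord c (inl j) * (u' i1)%:~R - coord c (inr j) * (u i1)%:~R) / D
    else if i == i1 then
      (coord c (inr j) * (u i0)%:~R - coord c (inl j) * (u' i0)%:~R) / D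
    else 0)
  (fun=> 0).
apply: (@torus_prob_averaging _ _ _ _ _ _ w).
- by apply: measurableI; exact: measurable_col_event.
- by apply: periodicI; exact: periodic_col_event.
- apply: measurable_mx_shift => [i j|i]; last exact: measurable_cst.
  under eq_fun do rewrite mxE; case: (i == i0); last case: (i == i1);
    last exact: measurable_cst.
    by apply: measurable_funM => //; apply: measurable_funB;
      apply: measurable_funM => //; exact: measurable_coord.
  by apply: measurable_funM => //; apply: measurable_funB;
    apply: measurable_funM => //; exact: measurable_coord.
- move=> x.
  pose y (i : 'I_n + 'I_n) := match i with inl j => col_form x u j | inr j =>
    col_form x u' j end.
  have h : lam R n n (ucube R n n `&` [set c | forall i,
      (match i with inl _ => B | inr _ => B' end) (coord c i + y i)]) = (b ^+ n
        * b' ^+ n)%:E.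
    rewrite (@lam_ucube_box n n
      (fun i => match i with inl _ => B | inr _ => B' end)
      (fun i => match i with inl _ => b | inr _ => b' end) y); try by case.
    by rewrite big_sumType/= !prodr_const !card_ord.
  have S c j (v : 'I_m -> int) : \sum_i w c (inl (mxvec_index i j)) * (v i)%:~R
    =
     (coord c (inl j) * (u' i1)%:~R - coord c (inr j) * (u i1)%:~R) / D * (v
       i0)%:~R +
     (coord c (inr j) * (u i0)%:~R - coord c (inl j) * (u' i0)%:~R) / D * (v
       i1)%:~R.
    rewrite (bigD1 i0)//= (bigD1 i1)//= !mxvecE !mxE !eqxx (negbTE i01) big1
      ?addr0// => i /andP[/negbTE ii0 /negbTE ii1].
    by rewrite mxvecE mxE ii0 ii1 mul0r.
  have E d j : col_form (shift x (w d)) u j = coord d (inl j) + col_form x u j.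
    by rewrite col_form_shift S /D; field.
  have E' d j : col_form (shift x (w d)) u' j = coord d (inr j) + col_form x u'
    j.
    by rewrite col_form_shift S /D; field.
  rewrite -h; congr (lam _ _ _ _); congr (_ `&` _); apply/seteqP; split => d.
    by move=> [h1 h2] [i|i]; rewrite /y; [rewrite -E; exact: h1|rewrite -E';
      exact: h2].
  by move=> h1; split => j; [rewrite E; exact: (h1 (inl j))|rewrite E';
    exact: (h1 (inr j))].
Qed.

End linear_forms.

(** * Convergence *)

Section hit.
Context {R : realType}.
Local Notation P := torus_prob.
Variables m n : nat.

(** The power stays on the distance, so that no [m]-th root of [theta] has to be taken. *)
Definition near_int_pow (theta : R) : set R :=
  [set x | exists p : int, `|x - p%:~R| ^+ m < theta].

(** Solvability of the system defining [Dhat] at height [T = 2 ^ (n k)], with [theta] in place of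
    [psi T]. *)
Definition hit (k : nat) (theta : R) : set (space R (m * n) m) :=
  [set z | exists q : {ffun 'I_n -> int},
    (forall j, `|q j| < 2 ^+ k) /\ row_event (near_int_pow theta) q z].

Lemma measurable_near_int_pow theta :
  measurable (near_int_pow theta : set (measurableTypeR R)).
Proof.
rewrite (_ : near_int_pow theta =
    \bigcup_(p in [set: int]) [set x : R | `|x - p%:~R| ^+ m < theta]).
  apply: countable_bigcupT_measurable; first exact: countableP.
  move=> p; rewrite -[X in measurable X]setTI.
  have mf : measurable_fun setT
      (fun x : measurableTypeR R => `|x - p%:~R| ^+ m : measurableTypeR R).
    apply: measurable_funX; apply: measurableT_comp => //.
    exact: measurable_funB.
  have := mf measurableT `]-oo, theta[%classic (measurable_itv _).
  congr (measurable _); congr (_ `&` _); apply/seteqP; split => x /=;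
    by rewrite in_itv.
apply/seteqP; split => x; first by move=> [p hp]; exists p.
by move=> [p _ hp]; exists p.
Qed.

Lemma periodic1_near_int_pow theta : periodic1 (near_int_pow theta).
Proof.
move=> x a; split=> -[p hp].
  by exists (p - a); rewrite intrB opprB addrA.
by exists (p + a); rewrite intrD opprD addrACA subrr addr0.
Qed.

Lemma measurable_hit k theta : measurable (hit k theta).
Proof.
rewrite (_ : hit k theta = \bigcup_(q in [set: {ffun 'I_n -> int}])
  (if [forall j, `|q j| < 2 ^+ k] then row_event (near_int_pow theta) q else
    set0)).
  apply: countable_bigcupT_measurable; first exact: countableP.
  move=> q; case: ifPn => _; last exact: measurable0.
  by apply: measurable_row_event; exact: measurable_near_int_pow.
apply/seteqP; split => z.
  by move=> [q [q1 q2]]; exists q => //; rewrite ifT//; exact/forallP.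
by move=> [q _]; case: ifPn => // /forallP q1 q2; exists q.
Qed.

Lemma periodic_hit k theta : periodic (hit k theta).
Proof.
have pE (q : {ffun 'I_n -> int}) :=
  @periodic_row_event R m n _ q (periodic1_near_int_pow theta).
move=> z a; split => -[q [q1 q2]]; exists q; split => //.
  by have /pE := q2.
by apply/(pE q z a).
Qed.

Lemma hit_le k theta theta' : theta <= theta' -> hit k theta `<=` hit k theta'.
Proof.
move=> tt' z [q [q1 q2]]; exists q; split => // i; have [p hp] := q2 i.
by exists p; exact: lt_le_trans tt'.
Qed.

Hypothesis m_gt0 : (0 < m)%N.

(* The uniform points [A q + b mod 1] are pairwise independent, so the second
   moment method bounds the probability that all of them miss a box. *)
Lemma row_miss_prob (k r : nat) : (0 < r)%N ->
  P (~` (\bigcup_(q in [set: {ffun 'I_n -> 'I_(2 ^ k)}])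
    @row_event R m n (near_int (2 * r%:R)^-1) (fun j => Posz (q j)))) <=
  r%:R ^+ m / 2 ^+ (n * k) :> R.
Proof.
move=> r0.
have r0' : 0 < r%:R :> R by rewrite ltr0n.
pose S (q : {ffun 'I_n -> 'I_(2 ^ k)}) : set (space R (m * n) m) :=
  row_event (near_int (2 * r%:R)^-1) (fun j => Posz (q j)).
have mN := @measurable_near_int R (2 * r%:R)^-1.
have pN := @periodic1_near_int R (2 * r%:R)^-1.
have rN : lebesgue_measure (`[0, 1[%classic `&` near_int (2 * r%:R)^-1) =
  (r%:R^-1)%:E :> \bar R.
  rewrite circle_near_int; last 2 first.
  - by rewrite invr_gt0 mulr_gt0.
  - by rewrite lef_pV2 ?posrE ?mulr_gt0// ler_peMr// ler1n.
  by rewrite invfM mulrA divff// mul1r.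
pose b : R := r%:R^-1 ^+ m.
have b0 : 0 < b by rewrite exprn_gt0// invr_gt0.
have mS q : measurable (S q) by exact: measurable_row_event.
have mU : measurable (\bigcup_(q in setT) S q).
  by apply: fin_bigcup_measurable.
pose N : R := 2 ^+ (n * k).
have N0 : 0 < N by rewrite exprn_gt0.
have cardN : #|{ffun 'I_n -> 'I_(2 ^ k)}|%:R = N.
  by rewrite card_ffun !card_ord -expnM mulnC natrX.
have PS q : P (S q) = b by exact: prob_row_event.
have PSS q q' : P (S q `&` S q') <= (q == q')%:R * b + b ^+ 2.
  have [->|qq'] := eqVneq q q'; first by rewrite setIid PS mul1r lerDl sqr_ge0.
  rewrite mul0r add0r expr2 /S (prob_row_eventI m mN pN rN)//.
  apply/existsP; apply: contraNT qq'; rewrite negb_exists => /forallP h.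
  apply/eqP/ffunP => j; apply/val_inj; have := h j; rewrite negbK => /eqP.
  by case.
(* The expected number of hits is [N b], and pairwise independence bounds its second moment by
   [N b + (N b) ^ 2]. The probability of no hit is then at most [1 / (1 + N b)]. *)
have := @chung_erdos R (m * n) m {ffun 'I_n -> 'I_(2 ^ k)} predT S
  (\bigcup_(q in setT) S q) (N * b) (N * b + (N * b) ^+ 2) mS mU.
have Nb0 : 0 < N * b by exact: mulr_gt0.
move=> /(_ _ _ _ Nb0 _) h.
have {}h : (N * b) ^+ 2 / (N * b + (N * b) ^+ 2) <= P (\bigcup_(q in setT) S q).
  apply: h.
  - by move=> q _ z Sz; exists q.
  - under eq_bigr do rewrite PS.
    by rewrite sumr_const -[_ *+ _]mulr_natl cardN.
  - apply: le_trans (_ : \sum_(i : {ffun 'I_n -> 'I_(2 ^ k)})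
        \sum_(j : {ffun 'I_n -> 'I_(2 ^ k)}) ((i == j)%:R * b + b ^+ 2) <= _).
      by apply: ler_sum => i _; apply: ler_sum => j _; exact: PSS.
    under eq_bigr => i _.
      rewrite big_split/= (bigD1 i)//= eqxx mul1r big1 ?addr0; last first.
        by move=> j ji; rewrite eq_sym (negbTE ji) mul0r.
      rewrite sumr_const -[_ *+ _]mulr_natl cardN; over.
    rewrite sumr_const -[_ *+ _]mulr_natl cardN.
    by rewrite le_eqVlt; apply/orP; left; apply/eqP; ring.
  - by rewrite addr_gt0// exprn_gt0.
rewrite torus_probC//.
apply: le_trans (_ : 1 - (N * b) ^+ 2 / (N * b + (N * b) ^+ 2) <= _).
  by rewrite lerB.
have -> : 1 - (N * b) ^+ 2 / (N * b + (N * b) ^+ 2) = (1 + N * b)^-1.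
  field; apply/andP; split; first by rewrite gt_eqF// addr_gt0.
  by rewrite gt_eqF// addr_gt0// exprn_gt0.
have -> : r%:R ^+ m / 2 ^+ (n * k) = (N * b)^-1.
  by rewrite invfM /b exprVn invrK mulrC.
by rewrite lef_pV2 ?posrE ?addr_gt0// lerDr.
Qed.

Lemma expr_ge_base (x : R) : 1 <= x -> x <= x ^+ m.
Proof.
by move=> x1; rewrite -[leLHS]expr1; exact: ler_weXn2l.
Qed.

(** The least integer [r >= 1] with [(2 r) ^ m theta >= 1] replaces a root of [theta]: the box of
    half-side [1 / (2 r)] fits into the target, and minimality bounds [r ^ m] by [1 / theta] unless
    [r = 1], which the summand [1] covers. *)
Lemma miss_prob (k : nat) (theta : R) : 0 < theta ->
  P (~` hit k theta) <= (1 + theta^-1) / 2 ^+ (n * k).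
Proof.
move=> t0.
have [r [r0 r1 r2]] : exists r : nat, [/\ (0 < r)%N,
    (2 * r%:R)^-1 ^+ m <= theta & r%:R ^+ m <= 1 + theta^-1 :> R].
  have ex : exists r : nat, 1 <= (2 * r.+1%:R) ^+ m * theta.
    exists (Num.bound theta^-1); rewrite -ler_pdivrMr// mul1r.
    have tv : 0 <= theta^-1 by rewrite invr_ge0 ltW.
    apply: (le_trans (ltW (archi_boundP tv))).
    apply: le_trans (expr_ge_base _); last by rewrite -natrM ler1n.
    by rewrite -natrM ler_nat; lia.
  case: (ex_minnP ex) => r hr min.
  have e0 : 0 < (2 * r.+1%:R) ^+ m :> R by rewrite exprn_gt0// mulr_gt0.
  exists r.+1; split => //.
    by rewrite exprVn -[leLHS]mul1r ler_pdivrMr// mulrC.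
  case: r {e0 hr} min => [|r] min.
    by rewrite expr1n lerDl invr_ge0 ltW.
  have : ~~ (1 <= (2 * r.+1%:R) ^+ m * theta) by apply/negP => /min;
    rewrite ltnn.
  rewrite -ltNge -ltr_pdivlMr// mul1r => h.
  apply: (le_trans (_ : _ <= (2 * r.+1%:R) ^+ m)).
    apply: lerXn2r; rewrite ?nnegrE ?mulr_ge0// -natrM ler_nat; lia.
  by apply: (le_trans (ltW h)); rewrite lerDr.
apply: le_trans (_ : r%:R ^+ m / 2 ^+ (n * k) <= _); last first.
  by rewrite ler_pM2r// invr_gt0 exprn_gt0.
apply: le_trans (row_miss_prob k r0).
apply: le_torus_prob.
- apply: measurableC; exact: measurable_hit.
- apply: measurableC; apply: fin_bigcup_measurable => // q _.
  by apply: measurable_row_event; exact: measurable_near_int.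
apply: subsetC => z [q _ qz]; exists [ffun j => Posz (q j)]; split.
  move=> j; rewrite ffunE ger0_norm//.
  have := ltn_ord (q j); rewrite -ltz_nat => /lt_le_trans; apply.
  by rewrite -natrX natz.
move=> i; have [p hp] := qz i; exists p.
have -> : row_form z [ffun j => Posz (q j)] i = row_form z (fun j => Posz (q
  j)) i.
  by rewrite /row_form; congr (_ + _); apply: eq_bigr => j _; rewrite ffunE.
by apply: lt_le_trans r1; rewrite ltr_pXn2r// nnegrE// invr_ge0 mulr_ge0.
Qed.

Lemma limsup_miss_prob (theta : nat -> R) (M : R) : (0 < n)%N ->
  (forall k, 0 < theta k) ->
  (forall N, \sum_(0 <= k < N) (theta k * 2 ^+ (n * k))^-1 <= M) ->
  P (\bigcap_K \bigcup_(k in [set k | (K <= k)%N]) ~` hit k (theta k)) = 0.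
Proof.
move=> n0 t0 tM.
(* The summand [1] of [miss_prob] contributes at most a geometric series of sum [2], because
   [2 ^ (n k) >= 2 ^ k]. *)
apply: (@torus_borel_cantelli R _ _ _
  (fun k => 2^-1 ^+ k + (theta k * 2 ^+ (n * k))^-1) (2 + M)).
- by move=> k; apply: measurableC; exact: measurable_hit.
- move=> k; apply: (le_trans (miss_prob k (t0 k))).
  rewrite mulrDl mul1r -invfM lerD2r exprVn lef_pV2 ?posrE ?exprn_gt0//.
  by apply: ler_weXn2l; [exact: ler1n|exact: leq_pmull].
- move=> N; rewrite big_split/=; apply: lerD => //.
  elim: N => [|N ih]; first by rewrite big_geq.
  suff h : forall K, \sum_(0 <= k < K) 2^-1 ^+ k = 2 - 2 * 2^-1 ^+ K :> R.
    by rewrite h lerBlDr lerDl mulr_ge0// exprn_ge0// invr_ge0.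
  elim=> [|K ihK]; first by rewrite big_geq// expr0 mulr1 subrr.
  by rewrite big_nat_recr//= ihK exprS; lra.
Qed.

End hit.

(** * Counting coprime pairs *)

Section coprime_counting.
Local Open Scope nat_scope.

Lemma sum_dvdn (d U : nat) : 0 < d -> \sum_(a < U) (d %| a.+1) = U %/ d.
Proof.
move=> d0; elim: U => [|U ih]; first by rewrite big_ord0 div0n.
by rewrite big_ord_recr/= ih divnS// addnC.
Qed.

Lemma not_coprime_le_sum (U a b : nat) : a <= U -> 0 < a ->
  (~~ coprime a b) <= \sum_(p < U.+1 | prime p) (p %| a) * (p %| b).
Proof.
move=> aU a0; have [//|nc] := boolP (coprime a b).
have g1 : 1 < gcdn a b by rewrite ltn_neqAle eq_sym nc/= gcdn_gt0 a0.
have pU : pdiv (gcdn a b) < U.+1.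
  rewrite ltnS (leq_trans _ aU)// (leq_trans (pdiv_leq _))// ?gcdn_gt0 ?a0//.
  by rewrite dvdn_leq// dvdn_gcdl.
rewrite (bigD1 (Ordinal pU))/= ?pdiv_prime//.
by rewrite !(dvdn_trans (pdiv_dvd _)) ?dvdn_gcdl ?dvdn_gcdr.
Qed.

(** Beyond [2] only odd numbers [2 x + 1] matter, and [1 / (2 x + 1) ^ 2 <= 1 / (4 x (x + 1))]
    telescopes. *)
Lemma sum_prime_sqr_inv (N : nat) :
  (\sum_(p < N | prime p) ((p%:R : rat) ^+ 2)^-1 <= 2^-1)%R.
Proof.
rewrite big_mkcond/=.
rewrite -(big_mkord xpredT (fun p => if prime p then ((p%:R : rat) ^+ 2)^-1
  else 0))%R.
suff H K : (\sum_(0 <= p < K.+1.*2.+1) (if prime p then ((p%:R : rat) ^+ 2)^-1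
  else 0)
    <= 2^-1 - (4 * K.+1%:R)^-1)%R.
  have NN : N <= N.+1.*2.+1 by rewrite -addnn; lia.
  apply: le_trans (le_trans (H N) _); last by rewrite lerBlDr lerDl invr_ge0
    mulr_ge0.
  rewrite [leRHS](big_cat_nat (n := N))//= lerDl sumr_ge0// => i _.
  by case: ifP => // _; rewrite invr_ge0 sqr_ge0.
elim: K => [|K ih].
  do 3 (rewrite big_nat_recr; last by []).
  rewrite big_geq; last by [].
  have -> : prime 0 = false by [].
  have -> : prime 1 = false by [].
  have -> : prime 1.*2 = true by [].
  cbv iota; rewrite -[1.*2]/2.
  have -> : (2^-1 - (4 * 1%:R)^-1 = 2%:R ^- 2 :> rat)%R by field.
  by rewrite [leLHS]add0r lexx.
rewrite !doubleS big_nat_recr//= big_nat_recr//=.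
have -> : prime K.+1.*2.+2 = false.
  by rewrite -doubleS; apply/negbTE/negP => /even_prime[];
    [lia|rewrite /= negbK odd_double].
rewrite addr0.
apply: le_trans (_ : 2^-1 - (4 * K.+1%:R)^-1 + ((K.+1.*2.+1%:R : rat) ^+ 2)^-1
  <= _)%R.
  apply: lerD => //; case: ifP => // _; by rewrite invr_ge0 sqr_ge0.
have -> : (K.+1.*2.+1%:R = 2 * K.+1%:R + 1 :> rat)%R.
  by rewrite -natrM natr1 mul2n.
have -> : (K.+2%:R = K.+1%:R + 1 :> rat)%R by rewrite natr1.
have : (0 < K.+1%:R :> rat)%R by rewrite ltr0n.
move: (K.+1%:R)%R => x x0.
have -> : (2^-1 - (4 * (x + 1))^-1 = 2^-1 - (4 * x)^-1 + (4 * x * (x +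
  1))^-1)%R.
  by field; lra.
by rewrite lerD2l lef_pV2 ?posrE; nra.
Qed.

(** A pair that is not coprime has a common prime [p]; the union bound over [p] discards at most
    [U ^ 2] times the sum of [1 / p ^ 2], that is, at most half of the pairs. *)
Lemma coprime_pairs_ge (U : nat) :
  U ^ 2 <= 2 * \sum_(a < U) \sum_(b < U) coprime a.+1 b.+1.
Proof.
have tot : \sum_(a < U) \sum_(b < U) coprime a.+1 b.+1 +
    \sum_(a < U) \sum_(b < U) ~~ coprime a.+1 b.+1 = U ^ 2.
  rewrite -big_split/= -mulnn -[in RHS](card_ord U) -sum_nat_const.
  rewrite card_ord; apply: eq_bigr => a _;
    rewrite -big_split/= -[RHS]muln1 -[in RHS](card_ord U) -sum_nat_const.
  by apply: eq_bigr => b _; case: coprime.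
suff nc : 2 * (\sum_(a < U) \sum_(b < U) ~~ coprime a.+1 b.+1) <= U ^ 2 by lia.
have h : \sum_(a < U) \sum_(b < U) ~~ coprime a.+1 b.+1 <=
    \sum_(p < U.+1 | prime p) (U %/ p) ^ 2.
  apply: leq_trans (_ : \sum_(a < U) \sum_(b < U)
      \sum_(p < U.+1 | prime p) (p %| a.+1) * (p %| b.+1) <= _).
    by apply: leq_sum => a _; apply: leq_sum => b _; exact: not_coprime_le_sum.
  under eq_bigr do rewrite exchange_big/=.
  rewrite exchange_big/=; apply: leq_sum => p pp.
  rewrite -mulnn -(sum_dvdn _ (prime_gt0 pp)) big_distrl/=.
  by apply: leq_sum => a _; rewrite big_distrr.
rewrite -(ler_nat rat) natrM natrX.
apply: le_trans (_ : 2 * (U%:R ^+ 2 * 2^-1) <= _)%R;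
  last by rewrite mulrCA divff// mulr1.
rewrite ler_pM2l//.
apply: le_trans (_ : (\sum_(p < U.+1 | prime p) (U %/ p) ^ 2)%:R <= _)%R;
  first by rewrite ler_nat.
apply: le_trans (_ : U%:R ^+ 2 * \sum_(p < U.+1 | prime p) ((p%:R : rat) ^+
  2)^-1 <= _)%R; last first.
  by apply: ler_wpM2l; [exact: sqr_ge0|exact: sum_prime_sqr_inv].
rewrite natr_sum mulr_sumr; apply: ler_sum => p pp.
have p0 : (0 < p%:R :> rat)%R by rewrite ltr0n prime_gt0.
rewrite natrX ler_pdivlMr ?exprn_gt0// -exprMn lerXn2r ?nnegrE ?mulr_ge0//.
by rewrite -natrM ler_nat leq_trunc_div.
Qed.

Lemma sum_coprime_totient (a : nat) : 0 < a ->
  \sum_(b < a) coprime a b.+1 = totient a.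
Proof.
case: a => // a _; rewrite totient_count_coprime big_mkord.
rewrite [RHS]big_ord_recl [LHS]big_ord_recr/= addnC; congr (_ + _).
by rewrite /coprime gcdnn gcdn0.
Qed.

(** Sorted by their larger entry, the coprime pairs are counted at most twice by the totients. *)
Lemma sum_totient_ge (U : nat) : U ^ 2 <= 4 * \sum_(a < U) totient a.+1.
Proof.
apply: (leq_trans (coprime_pairs_ge U)).
suff : \sum_(a < U) \sum_(b < U) coprime a.+1 b.+1 <=
    \sum_(a < U) totient a.+1 + \sum_(a < U) totient a.+1 by lia.
elim: U => [|U ih]; first by rewrite big_ord0.
rewrite big_ord_recr/=.
under eq_bigr do rewrite big_ord_recr/=.
rewrite big_split/= [X in _ <= X + X]big_ord_recr/=.
rewrite sum_coprime_totient//.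
have : \sum_(i < U) coprime i.+1 U.+1 <= totient U.+1.
  rewrite -sum_coprime_totient// big_ord_recr/= (eq_bigr (fun i : 'I_U =>
    coprime U.+1 i.+1 : nat)).
    exact: leq_addr.
  by move=> i _; rewrite coprime_sym.
move: ih; set A := \sum_(a < U) \sum_(b < U) _; set T := \sum_(a < U) totient _.
by set C := \sum_(i < U) _; move: A T C (totient U.+1) => A T C t; lia.
Qed.

(** The [a] with [8 totient(a) < a] contribute at most [U ^ 2 / 8] to a sum that is at least
    [U ^ 2 / 4], and every other [a] contributes at most [U]. *)
Lemma dense_totient (U : nat) :
  U <= 8 * \sum_(a < U) (a.+1 <= 8 * totient a.+1).
Proof.
case: U => // U; rewrite -(leq_pmul2l (ltn0Sn U)).
have h := sum_totient_ge U.+1.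
have h2 : 8 * \sum_(a < U.+1) totient a.+1 <=
    8 * (U.+1 * \sum_(a < U.+1) (a.+1 <= 8 * totient a.+1)) + U.+1 * U.+1.
  rewrite !big_distrr/= -[X in _ + X * _](card_ord U.+1) -sum_nat_const
    -big_split/=.
  apply: leq_sum => a _; have := ltn_ord a.
  have : totient a.+1 <= a.+1.
    by rewrite -sum_coprime_totient// -[leqRHS]muln1 -[in leqRHS](card_ord
      a.+1) -sum_nat_const; apply: leq_sum => b _; case: coprime.
  by case: leqP => /=; nia.
by nia.
Qed.

End coprime_counting.

(** * Approximation by reduced fractions *)

(* A pair is determined by its determinant, a multiple of [gcdn a b], and by the
   quotient of its first component by [a %/ gcdn a b]. *)
Lemma card_small_dets (R : realType) (a b : nat) (X : R) : (0 < a)%N -> (0 <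
  b)%N ->
  0 <= X ->
  #|[set pq : 'I_a * 'I_b | (pq.1 * b != pq.2 * a)%N &
      `|(pq.1 * b)%:R - (pq.2 * a)%:R| < X]|%:R <= 2 * X.
Proof.
move=> a0 b0 X0; pose d := gcdn a b.
have d0 : (0 < d)%N by rewrite gcdn_gt0 a0.
have d0' : 0 < d%:R :> R by rewrite ltr0n.
have [a1 ea] : exists a1, a = (a1 * d)%N by apply/dvdnP; exact: dvdn_gcdl.
have [b1 eb] : exists b1, b = (b1 * d)%N by apply/dvdnP; exact: dvdn_gcdr.
have a10 : (0 < a1)%N by move: a0; rewrite ea muln_gt0 => /andP[].
have cop : coprime a1 b1.
  by move: (erefl d); rewrite {1}/d {1}ea {1}eb -muln_gcdl /coprime -[X in _ =
    X]mul1n => /eqP; rewrite eqn_pmul2r.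
pose K := Num.trunc (X / d%:R).
have KX : K%:R * d%:R <= X.
  by rewrite -ler_pdivlMr// /K truncn_le// divr_ge0// ltW.
pose dist (p q : nat) := ((p * b1 - q * a1) + (q * a1 - p * b1))%N.
have distK p q : `|(p * b)%:R - (q * a)%:R| < X -> (dist p q <= K)%N.
  have Xd0 : 0 <= X / d%:R by rewrite divr_ge0.
  move=> h; rewrite /K truncn_ge_nat// ler_pdivlMr//.
  apply: le_trans (ltW h).
  have -> : (p * b)%:R - (q * a)%:R = ((p * b1)%:R - (q * a1)%:R) * d%:R :> R.
    by rewrite {1}ea {1}eb !natrM; ring.
  rewrite normrM (ger0_norm (ltW d0')).
  rewrite ler_pM2r// /dist natrD; case: (leqP (p * b1) (q * a1)) => hle.
    have /eqP -> : (p * b1 - q * a1 == 0)%N by rewrite subn_eq0.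
    by rewrite add0r natrB// distrC ler_norm.
  have /eqP -> : (q * a1 - p * b1 == 0)%N by rewrite subn_eq0 ltnW.
  by rewrite addr0 natrB ?ler_norm// ltnW.
set A := [set _ | _ & _].
(* The sign of the determinant, its absolute value in units of [d] (nonzero, hence counted from
   [1]), and the quotient of [p] by [a1]. The determinant fixes [p] modulo [a1], where [b1] is
   invertible. *)
pose f (pq : 'I_a * 'I_b) : bool * 'I_K.-1.+1 * 'I_d.-1.+1 :=
  ((pq.1 * b1 < pq.2 * a1)%N, inord (dist pq.1 pq.2).-1, inord (pq.1 %/ a1)).
have dist_gt0 (p q : nat) : (p * b != q * a)%N -> (0 < dist p q)%N.
  rewrite ea eb !mulnA eqn_pmul2r// /dist; lia.
have [K0|K0] := posnP K.
  rewrite (_ : A = finset.set0) ?cards0 ?mulr_ge0//; apply/setP => -[p q];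
    rewrite !inE/=.
  apply/negbTE/negP => /andP[/dist_gt0 h1 /distK].
  by rewrite K0 leqNgt h1.
have finj : {in A &, injective f}.
  move=> [p q] [p' q'] /=; rewrite !inE/= => /andP[h1 h2] /andP[h3 h4] [e1].
  move=> /(congr1 val)/= + /(congr1 val)/=.
  have dK := distK _ _ h2; have dK' := distK _ _ h4.
  have g0 := dist_gt0 _ _ h1; have g0' := dist_gt0 _ _ h3.
  have divd (r : 'I_a) : (r %/ a1 < d)%N.
    by rewrite ltn_divLR// mulnC -ea.
  rewrite !inordK ?prednK//; try by lia.
  move=> e2 e3.
  have e4 : (p * b1 + q' * a1 = p' * b1 + q * a1)%N.
    by move: e1 e2 g0 g0'; rewrite /dist; lia.
  have modeq (r r' s s' : nat) : (r' <= r)%N ->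
      (r * b1 + s' * a1 = r' * b1 + s * a1)%N -> r = r' %[mod a1].
    move=> rr' e; apply/eqP; rewrite eqn_mod_dvd// -(Gauss_dvdl _ cop) mulnBl.
    have -> : (r * b1 - r' * b1 = s * a1 - s' * a1)%N by lia.
    by rewrite -mulnBl dvdn_mull.
  have pp : p = p' %[mod a1].
    case/orP: (leq_total p p') => ?; last exact: (modeq p p' q q').
    by apply/esym/(modeq p' p q' q).
  have epp : p = p'.
    by apply/val_inj => /=; rewrite (divn_eq p a1) (divn_eq p' a1) e3 pp.
  congr (_, _) => //; apply/val_inj/eqP => /=.
  by rewrite -(eqn_pmul2r a10); apply/eqP; rewrite epp in e4; lia.
have : (#|A| <= 2 * K * d)%N.
  rewrite -(card_in_imset finj); apply: (leq_trans (max_card _)).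
  by rewrite !card_prod card_bool !card_ord !prednK.
rewrite -(ler_nat R) => /le_trans; apply.
by rewrite -mulnA !natrM ler_pM2l.
Qed.

Lemma measure_bigsetU_le d (T : measurableType d) (R : realType)
    (mu : {measure set T -> \bar R}) (I : Type) (r : seq I) (A : I -> set T)
    (Q : pred I) : (forall i, measurable (A i)) ->
  (mu (\big[setU/set0]_(i <- r | Q i) A i) <= \sum_(i <- r | Q i) mu (A i))%E.
Proof.
move=> mA.
suff : measurable (\big[setU/set0]_(i <- r | Q i) A i) /\
  (mu (\big[setU/set0]_(i <- r | Q i) A i) <= \sum_(i <- r | Q i) mu (A i))%E
    by case.
elim/big_rec2: _ => [|i x y _ [mx le]]; first by split => //; rewrite measure0.
split; first exact: measurableU.
by apply: (le_trans (measureU2 _ _ _)) => //; rewrite leeD2l.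
Qed.

Section reduced_fractions.
Context {R : realType}.
Local Notation mu := (@lebesgue_measure R).

(* Only reduced fractions are allowed: distinct denominators then never share a
   fraction, which keeps the intersections small. *)
Definition red_near (u : nat) (delta : R) : set R :=
  [set t | exists p : int, coprime u `|p|%N /\ `|t * u%:R - p%:~R| < delta].

Lemma measurable_red_near u delta :
  measurable (red_near u delta : set (measurableTypeR R)).
Proof.
rewrite (_ : red_near u delta = \bigcup_(p in [set: int])
    (if coprime u `|p|%N then [set x : R | `|x * u%:R - p%:~R| < delta] else
      set0)).
  apply: countable_bigcupT_measurable; first exact: countableP.
  move=> p; case: ifPn => _; last exact: measurable0.
  rewrite -[X in measurable X]setTI.
  have mf : measurable_fun setT
      (fun x : measurableTypeR R => `|x * u%:R - p%:~R| : measurableTypeR R).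
    apply: measurableT_comp => //; apply: measurable_funB => //.
    exact: measurable_funM.
  have := mf measurableT `]-oo, delta[%classic (measurable_itv _).
  congr (measurable _); congr (_ `&` _); apply/seteqP; split => x /=;
    by rewrite in_itv.
apply/seteqP; split => x; first by move=> [p [h hp]]; exists p => //; rewrite h.
by move=> [p _]; case: ifPn => // h hp; exists p.
Qed.

Let frac_itv (u : nat) (delta : R) (p : nat) : set (measurableTypeR R) :=
  `](p%:R - delta) / u%:R, (p%:R + delta) / u%:R[%classic.

Let frac_itvE (u : nat) (delta : R) (p : nat) (x : R) : (0 < u)%N ->
  frac_itv u delta p x <-> `|x * u%:R - p%:R| < delta.
Proof.
move=> u0; rewrite /frac_itv /= in_itv/= ltr_pdivrMr ?ltr0n// ltr_pdivlMr
  ?ltr0n//.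
by rewrite -ltr_distl.
Qed.

Let measure_frac_itv (u : nat) (delta : R) (p : nat) : (0 < u)%N -> 0 < delta ->
  mu (frac_itv u delta p) = (2 * delta / u%:R)%:E.
Proof.
move=> u0 d0; have u0' : 0 < u%:R :> R by rewrite ltr0n.
rewrite /frac_itv lebesgue_measure_itv/= lte_fin ltr_pM2r ?invr_gt0// ifT;
  last lra.
by rewrite -EFinB -mulrBl; congr (_%:E); congr (_ / _); lra.
Qed.

(** There is one interval around each reduced fraction [p / u]. These are disjoint as
    [delta <= 1/2], and they lie in the unit interval because [1 < u] excludes the numerator [0]. *)
Lemma measure_red_near_ge (u : nat) (delta : R) : (1 < u)%N -> 0 < delta ->
  delta <= 2^-1 ->
  ((2 * delta * (totient u)%:R / u%:R)%:E <= mu (`[0%R, 1%R[%classic `&`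
    red_near u delta))%E.
Proof.
move=> u1 d0 d1; have u0 : (0 < u)%N by exact: ltnW.
have u0' : 0 < u%:R :> R by rewrite ltr0n.
have tri : trivIset [set: 'I_u] (fun p : 'I_u => frac_itv u delta p).
  apply/trivIsetP => i j _ _ ij; apply/seteqP; split => // x [].
  move=> /(frac_itvE _ _ _ u0) h1 /(frac_itvE _ _ _ u0) h2.
  have : `|i%:R - j%:R| < 1 :> R.
    rewrite (_ : i%:R - j%:R = (x * u%:R - j%:R) - (x * u%:R - i%:R)); last lra.
    by apply: (le_lt_trans (ler_normB _ _)); lra.
  apply/negP; rewrite -leNgt; move: ij; rewrite -val_eqE/= neq_ltn => /orP[|] h.
    by rewrite distrC -natrB 1?ltnW// ger0_norm// ler1n subn_gt0.
  by rewrite -natrB 1?ltnW// ger0_norm// ler1n subn_gt0.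
apply: le_trans (_ : mu (\big[setU/set0]_(p < u | coprime u p) frac_itv u delta
  p) <= _)%E; last first.
  apply: le_measure; rewrite ?inE.
  - by apply: bigsetU_measurable => p _; exact: measurable_itv.
  - by apply: measurableI; [exact: measurable_itv|exact: measurable_red_near].
  move=> x; rewrite -bigcup_seq_cond => -[p /andP[_ cp] /(frac_itvE _ _ _ u0)
    h].
  split; last by exists (Posz p).
  rewrite /= in_itv/=.
  have p0 : (0 < p)%N.
    by rewrite lt0n; apply/eqP => p0; move: cp u1;
      rewrite p0 /coprime gcdn0 => /eqP ->.
  have p1 : (1 <= p%:R :> R) by rewrite ler1n.
  have p2 : (p%:R + 1 <= u%:R :> R) by rewrite natr1 ler_nat.
  move: h; rewrite ltr_distl => /andP[h1 h2].
  have x0 : 0 < x by rewrite -(pmulr_lgt0 x u0'); lra.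
  have : x * u%:R < 1 * u%:R by lra.
  by rewrite ltr_pM2r// => ->; rewrite ltW.
rewrite measure_bigsetU_ord//; last by move=> i; exact: measurable_itv.
rewrite (eq_bigr (fun=> (2 * delta / u%:R)%:E)); last first.
  by move=> i _; exact: measure_frac_itv.
rewrite sumEFin lee_fin sumr_const -[X in _ <= X]mulr_natr.
rewrite mulrAC ler_pM2l ?mulr_gt0 ?invr_gt0// ler_nat.
by rewrite totient_count_coprime big_mkord -sum1_card [leqRHS]big_mkcond/=
  leq_sum.
Qed.

(** Intervals around [p / u] and [p' / u'] meet only if the determinant [p u' - p' u] is smaller
    than [X], and it is nonzero because reduced fractions with distinct denominators differ. So at
    most [2 X] pairs of intervals meet. *)
Lemma measure_red_nearI_le (u u' : nat) (delta delta' : R) :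
  (1 < u)%N -> (1 < u')%N -> u != u' ->
  0 < delta -> delta <= 2^-1 -> 0 < delta' -> delta' <= 2^-1 ->
  (mu (`[0%R, 1%R[%classic `&` (red_near u delta `&` red_near u' delta')) <=
   (8 * delta * delta')%:E)%E.
Proof.
move=> u1 u1' uu' d0 d1 d0' d1'.
have u0 : (0 < u)%N by exact: ltnW.
have u0' : (0 < u')%N by exact: ltnW.
have ur0 : 0 < u%:R :> R by rewrite ltr0n.
have ur0' : 0 < u'%:R :> R by rewrite ltr0n.
pose X := delta * u'%:R + delta' * u%:R.
pose A := [set pq : 'I_u * 'I_u' | (pq.1 * u' != pq.2 * u)%N &
      `|(pq.1 * u')%:R - (pq.2 * u)%:R| < X]%SET.
have num (v : nat) (e : R) (x : R) (p : int) : (1 < v)%N -> e <= 2^-1 -> 0 <= x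
  < 1 ->
    coprime v `|p|%N -> `|x * v%:R - p%:~R| < e ->
    exists2 q : 'I_v, p = Posz q & coprime v q.
  move=> v1 e1 /andP[x0 x1] cp; rewrite ltr_distl => /andP[h1 h2].
  have v0 : 0 < v%:R :> R by rewrite ltr0n ltnW.
  have xv0 : 0 <= x * v%:R by rewrite mulr_ge0// ltW.
  have xv1 : x * v%:R < 1 * v%:R by rewrite ltr_pM2r.
  have pl : -1 < p%:~R :> R by lra.
  have pu : p%:~R < v%:R + 1 :> R by lra.
  rewrite -[-1]/((-1)%:~R) ltr_int in pl.
  rewrite -[v%:R]/(v%:~R) -[1]/(1%:~R) -intrD ltr_int in pu.
  case: p pl pu cp {h1 h2} => // p _ pu cp.
  have pv : (p < v)%N.
    have : (p <= v)%N by rewrite -lez_nat -ltzD1.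
    rewrite leq_eqVlt => /orP[/eqP pv|//].
    by move: cp v1; rewrite /= pv /coprime gcdnn => /eqP ->.
  by exists (Ordinal pv).
apply: le_trans (_ : mu (\big[setU/set0]_(pq <- enum A)
    (frac_itv u delta pq.1 `&` frac_itv u' delta' pq.2)) <= _)%E.
  apply: le_measure; rewrite ?inE.
  - apply: measurableI; first exact: measurable_itv.
    by apply: measurableI; exact: measurable_red_near.
  - by apply: bigsetU_measurable => pq _; apply: measurableI;
    exact: measurable_itv.
  move=> x [/=]; rewrite in_itv/= => x01 [[p [cp hp]] [p' [cp' hp']]].
  have [q qE cq] := num _ _ _ _ u1 d1 x01 cp hp.
  have [q' qE' cq'] := num _ _ _ _ u1' d1' x01 cp' hp'.
  subst p p'; rewrite -bigcup_seq/=; exists (q, q').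
    rewrite /= mem_enum inE/=; apply/andP; split.
      apply: contra uu' => /eqP e; rewrite eqn_dvd; apply/andP; split.
        by rewrite -(Gauss_dvdr u' cq) e dvdn_mull.
      by rewrite -(Gauss_dvdr u cq') -e dvdn_mull.
    rewrite !natrM (_ : _ - _ = (x * u'%:R - q'%:R) * u%:R - (x * u%:R - q%:R)
      * u'%:R); last by ring.
    apply: (le_lt_trans (ler_normB _ _));
      rewrite !normrM !(@ger0_norm _ (_%:R))//.
    by rewrite /X addrC; apply: ltrD; rewrite ltr_pM2r.
  by split; apply/frac_itvE.
apply: (le_trans (measure_bigsetU_le _ _ _ _)).
  by move=> pq; apply: measurableI; exact: measurable_itv.
(* Each of the two summands of [X] is multiplied by the length whose denominator it cancels; each
   product contributes [4 delta delta']. *)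
pose c := Num.min (2 * delta / u%:R) (2 * delta' / u'%:R).
apply: le_trans (_ : \sum_(pq <- enum A) c%:E <= _)%E.
  apply: lee_sum => pq _; rewrite /c EFin_min le_min; apply/andP; split.
    rewrite -(measure_frac_itv pq.1 u0 d0); apply: le_measure; rewrite ?inE.
    - by apply: measurableI; exact: measurable_itv.
    - exact: measurable_itv.
    - exact: subIsetl.
  rewrite -(measure_frac_itv pq.2 u0' d0'); apply: le_measure; rewrite ?inE.
  - by apply: measurableI; exact: measurable_itv.
  - exact: measurable_itv.
  - exact: subIsetr.
rewrite big_enum/= sumEFin lee_fin sumr_const -[X in X <= _]mulr_natl.
have X0 : 0 <= X by rewrite addr_ge0 ?mulr_ge0 ?ltW.
have c0 : 0 <= c by rewrite le_min; apply/andP; split;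
  rewrite divr_ge0 ?mulr_ge0 ?ltW.
apply: le_trans (_ : 2 * X * c <= _).
  by apply: ler_wpM2r => //; exact: card_small_dets.
rewrite /X mulrDr mulrDl (_ : 8 * delta * delta' = 4 * delta * delta' + 4 *
  delta * delta'); last by ring.
apply: lerD.
  apply: le_trans (_ : 2 * (delta * u'%:R) * (2 * delta' / u'%:R) <= _).
    by apply: ler_wpM2l; [rewrite !mulr_ge0// ltW|rewrite /c ge_min lexx orbT].
  by rewrite le_eqVlt; apply/orP; left; apply/eqP; field; rewrite gt_eqF.
apply: le_trans (_ : 2 * (delta' * u%:R) * (2 * delta / u%:R) <= _).
  by apply: ler_wpM2l; [rewrite !mulr_ge0// ltW|rewrite /c ge_min lexx].
by rewrite le_eqVlt; apply/orP; left; apply/eqP; field; rewrite gt_eqF.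
Qed.

End reduced_fractions.

(** * Divergence *)

Section divergence.
Context {R : realType}.
Local Notation P := torus_prob.
Variables m n : nat.
Hypotheses (m_gt0 : (0 < m)%N) (n_gt0 : (0 < n)%N).

Lemma sum_row_form (z : space R (m * n) m) q (u : 'I_m -> int) :
  \sum_i row_form z q i * (u i)%:~R =
  \sum_j col_form z u j * (q j)%:~R + vec_form z u.
Proof.
rewrite /row_form; under eq_bigr do rewrite mulrDl.
rewrite big_split/=; congr (_ + _).
under eq_bigr do rewrite mulr_suml; rewrite exchange_big/=.
by apply: eq_bigr => j _; rewrite mulr_suml; apply: eq_bigr => i _;
  rewrite mulrAC.
Qed.

(* If [A^T u] is within [1 / (8 n 2^k)] of the integers, then the points
   [A q + b] with [|q| < 2^k] lie near the hyperplanes [u . x = u . b mod 1],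
   which avoid a neighbourhood of the integer points. *)
Lemma bad_config_miss k theta (U : nat) (u : {ffun 'I_m -> nat}) :
  (forall i, (u i <= U)%N) -> (8 * m * U)%:R ^+ m * theta <= 1 ->
  col_event (near_int (8 * n%:R * 2 ^+ k)^-1) (fun i => Posz (u i)) `&`
  vec_event (~` near_int (4^-1)) (fun i => Posz (u i)) `<=`
  ~` @hit R m n k theta.
Proof.
move=> uU Ut z [zc zv] [q [q1 q2]]; apply: zv.
have [v hv] := choice zc; have [p hp] := choice q2.
(* The integer that [u . b] would approximate if [q] were a solution, obtained by pairing the
   integers near [A q + b] with [u] and those near [A^T u] with [q]. *)
pose c : int := \sum_i p i * Posz (u i) - \sum_j v j * q j.
exists c.
have E : vec_form z (fun i => Posz (u i)) - c%:~R =
    \sum_i (row_form z q i - (p i)%:~R) * (u i)%:R -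
    \sum_j (col_form z (fun i => Posz (u i)) j - (v j)%:~R) * (q j)%:~R.
  have -> : \sum_i (row_form z q i - (p i)%:~R) * (u i)%:R =
      \sum_i row_form z q i * (Posz (u i))%:~R - (\sum_i p i * Posz (u i))%:~R.
    rewrite (raddf_sum (intmul 1))/= -sumrB; apply: eq_bigr => i _.
    by rewrite mulrBl intrM.
  have -> : \sum_j (col_form z (fun i => Posz (u i)) j - (v j)%:~R) * (q j)%:~R
    =
      \sum_j col_form z (fun i => Posz (u i)) j * (q j)%:~R - (\sum_j v j * q
        j)%:~R.
    rewrite (raddf_sum (intmul 1))/= -sumrB; apply: eq_bigr => j _.
    by rewrite mulrBl intrM.
  by rewrite (sum_row_form z q (fun i => Posz (u i))) /c intrB; ring.
have m0 : 0 < m%:R :> R by rewrite ltr0n.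
have n0 : 0 < n%:R :> R by rewrite ltr0n.
have k0 : 0 < 2 ^+ k :> R by rewrite exprn_gt0.
(* Both errors are at most [1/8], the second one strictly, which puts [u . b] within [1/4] of [c].
   The first is estimated through [m]-th powers, the form in which smallness is given. *)
have B1 : `|\sum_i (row_form z q i - (p i)%:~R) * (u i)%:R| <= 8^-1.
  apply: (le_trans (ler_norm_sum _ _ _)).
  apply: le_trans (_ : \sum_(i < m) (8 * m%:R)^-1 <= _); last first.
    by rewrite sumr_const card_ord -[X in X <= _]mulr_natr invfM mulfVK ?gt_eqF.
  apply: ler_sum => i _; rewrite normrM (ger0_norm (ler0n _ _)).
  set x := `|_|.
  have x0 : 0 <= x by exact: normr_ge0.
  have : (8 * m * U)%:R * x <= 1.
    rewrite -(@expr_le1 _ m)// ?mulr_ge0// exprMn (le_trans _ Ut)//.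
    by apply: ler_wpM2l; rewrite ?exprn_ge0// ltW//; exact: hp.
  rewrite -[X in _ -> _ <= X]mul1r ler_pdivlMr ?mulr_gt0// => h.
  apply: le_trans h; rewrite !natrM.
  have : (u i)%:R <= U%:R :> R by rewrite ler_nat.
  move=> h; rewrite [leRHS](_ : _ = (x * (8 * m%:R)) * U%:R); last by ring.
  rewrite [leLHS](_ : _ = (x * (8 * m%:R)) * (u i)%:R); last by ring.
  by apply: ler_wpM2l => //; rewrite !mulr_ge0.
have B2 : `|\sum_j (col_form z (fun i => Posz (u i)) j - (v j)%:~R) * (q
  j)%:~R| < 8^-1.
  apply: (le_lt_trans (ler_norm_sum _ _ _)).
  apply: lt_le_trans (_ : \sum_(j < n) (8 * n%:R)^-1 <= _); last first.
    by rewrite sumr_const card_ord -[X in X <= _]mulr_natr invfM mulfVK ?gt_eqF.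
  apply: ltr_sum; first by apply/hasP; exists (Ordinal n_gt0);
    rewrite ?mem_index_enum.
  move=> j _; rewrite normrM.
  apply: le_lt_trans (_ : `|col_form z (fun i => Posz (u i)) j - (v j)%:~R| * 2
    ^+ k < _).
    apply: ler_wpM2l => //; rewrite -intr_norm.
    have := q1 j => /ltW; rewrite -(ler_int R) => /le_trans; apply.
    by rewrite rmorphXn.
  by rewrite -ltr_pdivlMr// -invfM; exact: hv.
by rewrite E; apply: (le_lt_trans (ler_normB _ _)); lra.
Qed.

Lemma geometric_tail (k L : nat) : (k <= L)%N ->
  \sum_(k <= j < L) (2 ^+ (n * j))^-1 <= 2 * (2 ^+ (n * k))^-1 :> R.
Proof.
move=> kL.
suff H : forall L, (k <= L)%N -> \sum_(k <= j < L) (2 ^+ (n * j))^-1 <=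
    2 * (2 ^+ (n * k))^-1 - 2 * (2 ^+ (n * L))^-1 :> R.
  by apply: (le_trans (H _ kL)); rewrite lerBlDr lerDl mulr_ge0// invr_ge0
    exprn_ge0.
elim=> [|{}L ih] {}kL.
  by move: kL; rewrite leqn0 => /eqP ->; rewrite big_geq// subrr.
move: kL; rewrite leq_eqVlt => /orP[/eqP <-|]; first by rewrite big_geq// subrr.
rewrite ltnS => kL; rewrite big_nat_recr//=.
apply: (le_trans (lerD (ih kL) (lexx _))).
have : 2 * (2 ^+ (n * L.+1))^-1 <= (2 ^+ (n * L))^-1 :> R.
  rewrite mulnS exprD invfM mulrA -[leRHS]mul1r ler_pM2r ?invr_gt0 ?exprn_gt0//.
  by rewrite ler_pdivrMr ?exprn_gt0// mul1r -[leLHS]expr1 ler_weXn2l// ler1n.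
by move=> h; lra.
Qed.

Context (good : {ffun 'I_m -> nat} -> bool)
  (G : {ffun 'I_m -> nat} -> R -> set (space R (m * n) m)).

Let up N (u : {ffun 'I_m -> 'I_N.+1}) : {ffun 'I_m -> nat} := [ffun i =>
  nat_of_ord (u i)].

Hypothesis good_count : forall N U : nat, (U <= N)%N ->
  (U ^ m <= 8 * #|[set u : {ffun 'I_m -> 'I_N.+1} | good (up u) & [forall i, (u
    i <= U)%N]]|.+1)%N.
Hypothesis measurable_G : forall u d, measurable (G u d).
Hypothesis prob_G : forall u d, good u -> 0 < d -> d <= 8^-1 ->
  (d / 4) ^+ n / 2 <= P (G u d).
Hypothesis prob_GI : forall u u' d d', good u -> good u' -> u != u' ->
  0 < d -> d <= 8^-1 -> 0 < d' -> d' <= 8^-1 -> P (G u d `&` G u' d') <= (8 * d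
    * d') ^+ n.
Hypothesis G_sub : forall u d, G u d `<=`
  col_event (near_int d) (fun i => Posz (u i)) `&`
  vec_event (~` near_int (4^-1)) (fun i => Posz (u i)).

(** Divergence supplies enough obstructions to make their expected number [s] at least [1].
    Quasi-independence bounds the second moment by [s + C s ^ 2], and
    [s ^ 2 / (s + C s ^ 2) >= 1 / (1 + C)] whatever [theta] is. *)
Lemma liminf_hit_prob_le (theta : nat -> R) (K : nat) :
  (forall k, 0 < theta k) ->
  (forall M, exists L, M < \sum_(0 <= k < L) (theta k * 2 ^+ (n * k))^-1) ->
  P (\bigcap_(k in [set k | (K <= k)%N]) @hit R m n k (theta k)) <=
  1 - (1 + 4 * 128 ^+ n)^-1.
Proof.
move=> t0 tdiv.
have m0 : 0 < m%:R :> R by rewrite ltr0n.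
have n0 : 0 < n%:R :> R by rewrite ltr0n.
have n1 : 1 <= n%:R :> R by rewrite ler1n.
(* The largest size allowed for [u] at scale [k]. By maximality [U + 1] is too large; [U + 1 <= 2 U]
   turns [8] into [16], and the summand [1] covers [U = 0]. *)
have exU k : {U : nat | (8 * m * U)%:R ^+ m * theta k <= 1 /\
    (theta k)^-1 <= (16 * m%:R) ^+ m * (U%:R ^+ m + 1)}.
  apply: cid.
  have ex : exists U : nat, (8 * m * U)%:R ^+ m * theta k <= 1.
    by exists 0%N; rewrite muln0 expr0n eqn0Ngt m_gt0 mul0r.
  have ub U : (8 * m * U)%:R ^+ m * theta k <= 1 -> (U <= Num.bound (theta
    k)^-1)%N.
    rewrite -ler_pdivlMr// mul1r => h.
    have tv : 0 <= (theta k)^-1 by rewrite invr_ge0 ltW.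
    have [->//|U0] := posnP U.
    rewrite -(ler_nat R); apply: le_trans (ltW (archi_boundP tv)).
    apply: le_trans h; apply: le_trans (expr_ge_base m_gt0 _);
      last by rewrite ler1n; nia.
    by rewrite ler_nat; nia.
  case: (ex_maxnP ex ub) => U hU max; exists U; split => //.
  have : ~~ ((8 * m * U.+1)%:R ^+ m * theta k <= 1) by apply/negP => /max;
    rewrite ltnn.
  rewrite -ltNge -ltr_pdivrMr// mul1r => /ltW /le_trans; apply.
  have -> : (16 * m%:R) ^+ m * (U%:R ^+ m + 1) = (8 * m%:R) ^+ m * (2 ^+ m *
    (U%:R ^+ m + 1)) :> R.
    by rewrite mulrA -exprMn; congr (_ ^+ _ * _); ring.
  rewrite !natrM exprMn; apply: ler_wpM2l;
    first by rewrite exprn_ge0// mulr_ge0.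
  have [->|U0] := posnP U.
    by rewrite expr1n expr0n eqn0Ngt m_gt0 add0r mulr1 exprn_ege1// ler1n.
  apply: le_trans (_ : 2 ^+ m * U%:R ^+ m <= _); last first.
    by apply: ler_wpM2l; rewrite ?exprn_ge0// lerDl.
  by rewrite -exprMn lerXn2r ?nnegrE ?mulr_ge0// -natrM ler_nat; lia.
pose U k := projT1 (exU k).
have hU k : (8 * m * U k)%:R ^+ m * theta k <= 1 by rewrite /U;
  case: (exU k) => ? [].
have hU' k : (theta k)^-1 <= (16 * m%:R) ^+ m * ((U k)%:R ^+ m + 1).
  by rewrite /U; case: (exU k) => ? [].

pose a k : R := (2 ^+ (n * k))^-1.
have a0 k : 0 < a k by rewrite invr_gt0 exprn_gt0.
pose C1 : R := 9 * (16 * m%:R) ^+ m.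
have C10 : 0 < C1 by rewrite mulr_gt0// exprn_gt0// mulr_gt0.
pose c1 : R := (32 * n%:R) ^- n / 2.
have c10 : 0 < c1 by rewrite mulr_gt0// invr_gt0 exprn_gt0// mulr_gt0.
(* The first sum removes the scales below [K]. The last [2] pays for the summand [1] in [v + 1], a
   geometric series, and [2 / c1] is twice what is needed since half is lost when each vector keeps
   a single scale. *)
have [L hL] := tdiv (\sum_(0 <= k < K) (theta k * 2 ^+ (n * k))^-1 + C1 * (2 *
  c1^-1 + 2)).
have KL : (K <= L)%N.
  rewrite leqNgt; apply/negP => LK; move: hL; rewrite ltNge => /negP; apply.
  rewrite [leRHS](_ : _ = \sum_(0 <= k < L) (theta k * 2 ^+ (n * k))^-1 +
    (\sum_(L <= k < K) (theta k * 2 ^+ (n * k))^-1 + C1 * (2 * c1^-1 + 2)));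
      last first.
    by rewrite [RHS]addrA; congr (_ + _);
      rewrite (big_cat_nat (n := L))//= ltnW.
  rewrite lerDl addr_ge0//.
    by apply: sumr_ge0 => k _; rewrite invr_ge0 mulr_ge0// ltW.
  by rewrite mulr_ge0 ?addr_ge0 ?mulr_ge0 ?invr_ge0// ltW.
have {}hL : C1 * (2 * c1^-1 + 2) < \sum_(K <= k < L) (theta k * 2 ^+ (n *
  k))^-1.
  by move: hL; rewrite [ltRHS](big_cat_nat (n := K))//= ltrD2l.
pose N := (\max_(k < L) U k)%N.
have UN k : (k < L)%N -> (U k <= N)%N.
  by move=> kL; exact: (@leq_bigmax _ (fun k : 'I_L => U k) (Ordinal kL)).
pose small (u : {ffun 'I_m -> 'I_N.+1}) k := [forall i, (u i <= U k)%N].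
pose J := [set u : {ffun 'I_m -> 'I_N.+1} | good (up u) & [exists k : 'I_L, (K
  <= k)%N && small u k]].
pose v k := #|[set u : {ffun 'I_m -> 'I_N.+1} | good (up u) & small u k]|.
have vlow k : (k < L)%N -> (theta k * 2 ^+ (n * k))^-1 <= C1 * ((v k)%:R + 1) *
  a k.
  move=> kL; rewrite invfM; apply: ler_wpM2r; first exact: ltW.
  apply: (le_trans (hU' k)).
  rewrite /C1 [9 * _]mulrC -mulrA; apply: ler_wpM2l;
    first by rewrite exprn_ge0// mulr_ge0.
  have := good_count (UN k kL); rewrite -/(v k) -(ler_nat R) natrX natrM -natr1.
  have : 0 <= (v k)%:R :> R by rewrite ler0n.
  by move=> h1 h2; lra.
have vsum : 2 * c1^-1 <= \sum_(K <= k < L) (v k)%:R * a k.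
  have : C1 * (2 * c1^-1 + 2) <= C1 * \sum_(K <= k < L) ((v k)%:R + 1) * a k.
    apply: (le_trans (ltW hL)); rewrite mulr_sumr big_nat [leRHS]big_nat.
    by apply: ler_sum => k /andP[_ kL]; rewrite mulrA; exact: vlow.
  rewrite ler_pM2l//.
  have : \sum_(K <= k < L) a k <= 2.
    apply: (le_trans (geometric_tail KL)); rewrite -[leRHS]mulr1 ler_pM2l//.
    by rewrite invf_le1 ?exprn_gt0// exprn_ege1// ler1n.
  under [in X in _ -> X -> _]eq_bigr do rewrite mulrDl mul1r.
  by rewrite big_split/= => h1 h2; lra.
(* [kk u] is the first scale from [K] on that admits [u]. With one scale per vector, distinct events
   belong to distinct vectors, as [prob_GI] requires. *)
have exkk (u : {ffun 'I_m -> 'I_N.+1}) : exists k, u \in J ->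
    [/\ (K <= k)%N, small u k & forall l, (K <= l)%N -> small u l -> (k <=
      l)%N].
  have [uJ|] := boolP (u \in J); last by exists 0%N.
  have ex : exists k, (K <= k)%N && small u k.
    by move: uJ; rewrite inE => /andP[_ /existsP[k hk]]; exists k.
  case: (ex_minnP ex) => k /andP[Kk sk] min; exists k => _; split => // l Kl sl.
  by apply: min; rewrite Kl.
have [kk hkk] := choice exkk.
pose d k : R := (8 * n%:R * 2 ^+ k)^-1.
have d0 k : 0 < d k by rewrite invr_gt0 !mulr_gt0// exprn_gt0.
have d1 k : d k <= 8^-1.
  rewrite lef_pV2 ?posrE ?mulr_gt0 ?exprn_gt0// -mulrA ler_peMr//.
  by rewrite mulr_ege1// exprn_ege1// ler1n.
have da k : (d k / 4) ^+ n / 2 = c1 * a k.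
  rewrite /c1 /a mulrAC; congr (_ / _).
  have -> : 2 ^+ (n * k) = (2 ^+ k) ^+ n :> R by rewrite -exprM mulnC.
  have -> : d k / 4 = (32 * n%:R * 2 ^+ k)^-1.
    by rewrite /d -invfM; congr (_^-1); ring.
  by rewrite exprVn exprMn invfM.
pose S u := G (up u) (d (kk u)).
have JG u : u \in J -> good (up u) by rewrite inE => /andP[].
have upinj : injective (@up N).
  move=> u u' e; apply/ffunP => i; apply/val_inj;
    have := congr1 (fun f : {ffun _} => f i) e.
  by rewrite !ffunE.
pose s := \sum_(u in J) P (S u).
(* Exchanging the sums, all scales that admit [u] together weigh at most [2 a (kk u)], by the
   geometric tail. *)
have s1 : 1 <= s.
  apply: le_trans (_ : \sum_(u in J) c1 * a (kk u) <= _); last first.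
    by apply: ler_sum => u uJ; rewrite -da; apply: prob_G => //; exact: JG.
  rewrite -mulr_sumr -ler_pdivrMl// mulr1.
  have : 2 * c1^-1 <= 2 * \sum_(u in J) a (kk u).
    apply: (le_trans vsum).
    have -> : \sum_(K <= k < L) (v k)%:R * a k =
        \sum_(K <= k < L) \sum_(u in J | small u k) a k.
      apply: eq_big_nat => k /andP[Kk kL]; rewrite sumr_const mulr_natl;
        congr (_ *+ _).
      apply: eq_card => u; rewrite [LHS]inE [RHS]unfold_in /= [in RHS]inE.
      apply/andP/andP => [[g sk]|[/andP[g _] sk]]; split => //; rewrite g/=.
      by apply/existsP; exists (Ordinal kL); rewrite Kk.
    under eq_bigr do rewrite big_mkcondr/=.
    rewrite exchange_big/= mulr_sumr; apply: ler_sum => u uJ.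
    have [Kk sk min] := hkk u uJ.
    have kkL : (kk u < L)%N.
      move: uJ; rewrite inE => /andP[_ /existsP[k /andP[k1 k2]]].
      by apply: leq_ltn_trans (ltn_ord k); exact: min.
    apply: le_trans (geometric_tail (ltnW kkL)).
    rewrite (big_cat_nat (n := kk u))//=; last exact: ltnW.
    rewrite big_nat big1 ?add0r => [|k /andP[k1 k2]]; last first.
      by case: ifP => // h; have := min k k1 h; rewrite leqNgt k2.
    by apply: ler_sum => k _; case: ifP => // _; exact: ltW.
  by rewrite ler_pM2l.
(* Chosen so that [(8 d d') ^ n] is [C] times the product of the lower bounds [(d / 4) ^ n / 2] and
   [(d' / 4) ^ n / 2]. *)
pose C : R := 4 * 128 ^+ n.
have C0 : 0 < C by rewrite mulr_gt0// exprn_gt0.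
have Plow u : u \in J -> (d (kk u) / 4) ^+ n / 2 <= P (S u).
  by move=> uJ; apply: prob_G => //; exact: JG.
pose V := \bigcup_(u in [set` J]) S u.
have mV : measurable V.
  by apply: fin_bigcup_measurable => // u _; exact: measurable_G.
have CE := @chung_erdos R (m * n) m {ffun 'I_m -> 'I_N.+1} (mem J) S V s (s + C
  * s ^+ 2)
  (fun u => measurable_G _ _) mV.
have s0 : 0 < s by exact: lt_le_trans s1.
have e0 : 0 < s + C * s ^+ 2 by rewrite addr_gt0// mulr_gt0// exprn_gt0.
have hV : (1 + C)^-1 <= P V.
  apply: le_trans (CE _ _ _ s0 e0).
  - have -> : s ^+ 2 / (s + C * s ^+ 2) = (s^-1 + C)^-1.
      field; apply/and3P; split; rewrite gt_eqF// addr_gt0// mulr_gt0//.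
    rewrite lef_pV2 ?posrE ?addr_gt0 ?invr_gt0// lerD2r invf_le1//.
  - by move=> u uJ z Sz; exists u.
  - by [].
  - apply: le_trans (_ : \sum_(u in J) (P (S u) + \sum_(u' in J) C * (P (S u) *
    P (S u'))) <= _).
      apply: ler_sum => u uJ.
      rewrite (bigD1 u)//= setIid lerD2l [leRHS](bigD1 u)//=.
      rewrite -[leLHS]add0r; apply: lerD.
        by rewrite !mulr_ge0 ?torus_prob_ge0// ltW.
      apply: ler_sum => u' /andP[uJ' uu'].
      apply: (le_trans (prob_GI (JG _ uJ) (JG _ uJ') _ (d0 _) (d1 _) (d0 _) (d1
        _))).
        by apply: contra uu' => /eqP/upinj ->.
      apply: le_trans (_ : C * ((d (kk u) / 4) ^+ n / 2 * ((d (kk u') / 4) ^+ n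
        / 2)) <= _).
        rewrite /C le_eqVlt; apply/orP; left; apply/eqP.
        rewrite (_ : 4 * 128 ^+ n * _ = 128 ^+ n * (d (kk u) / 4) ^+ n * (d (kk
          u') / 4) ^+ n); last by field.
        by rewrite -!exprMn; congr (_ ^+ _); field.
      apply: ler_wpM2l; first exact: ltW.
      have dn0 k : 0 <= (d k / 4) ^+ n / 2 by rewrite divr_ge0// exprn_ge0//
        divr_ge0// ltW.
      by apply: ler_pM => //; exact: Plow.
    rewrite big_split/= lerD2l.
    under eq_bigr do rewrite -mulr_sumr -mulr_sumr.
    by rewrite -mulr_sumr -mulr_suml -expr2.
set H := \bigcap_(k in _) _.
have mH : measurable H.
  by apply: bigcap_measurable => [|k _]; [exists K => /=|exact: measurable_hit].
have : P V <= P (~` H).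
  apply: le_torus_prob => //; first exact: measurableC.
  move=> z [u uJ Sz] Hz.
  have [Kk /forallP sk _] := hkk u uJ.
  have := Hz (kk u) Kk.
  apply: (@bad_config_miss _ _ (U (kk u)) (up u)) => //.
    by move=> i; rewrite ffunE.
  exact: G_sub Sz.
by rewrite torus_probC// => h; rewrite -/C; lra.
Qed.

End divergence.

(** * Families of integer vectors for [m >= 2] and for [m = 1] *)

Section divergence_instances.
Context {R : realType}.
Local Notation P := torus_prob.
Local Notation mu := (@lebesgue_measure R).

Lemma lam_ucube_coord_box k l (A : 'I_k + 'I_l -> set R) :
  (forall i, measurable (A i : set (measurableTypeR R))) ->
  lam R k l (ucube R k l `&` [set z | forall i, A i (coord z i)]) =
  (\prod_i mu (`[0%R, 1%R[%classic `&` A i))%E.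
Proof.
move=> mA.
rewrite (_ : _ `&` _ = [set z | forall i, (`[0%R, 1%R[%classic `&` A i) (coord
  z i)]).
  by apply: lam_box => i; apply: measurableI => //; exact: measurable_itv.
apply/seteqP; split => z.
  by move=> [h1 h2] i; split; [rewrite /= in_itv/=; exact: h1|exact: h2].
by move=> h; split => i; have [] := h i; rewrite //= in_itv.
Qed.

Lemma unit_itv_fin (A : set R) : measurable (A : set (measurableTypeR R)) ->
  mu (`[0%R, 1%R[%classic `&` A) \is a fin_num.
Proof.
move=> mA; rewrite ge0_fin_numE ?measure_ge0//.
apply: le_lt_trans (_ : mu `[0%R, 1%R[%classic < _)%E.
  apply: le_measure; rewrite ?inE; [|exact: measurable_itv|exact: subIsetl].
  by apply: measurableI => //; exact: measurable_itv.
by rewrite lebesgue_measure_itv/= lte_fin ltr01 -EFinB ltry.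
Qed.

Lemma mu_unit_itv : mu (`[0%R, 1%R[%classic `&` setT) = 1%E.
Proof. by rewrite setIT lebesgue_measure_itv/= lte_fin ltr01 sube0. Qed.

Section planar.
Variables m n : nat.
Hypothesis n_gt0 : (0 < n)%N.

(* No two distinct vectors of this kind are parallel. *)
Definition coprime_vec (u : {ffun 'I_m.+2 -> nat}) :=
  [&& (0 < u ord0)%N, (0 < u (lift ord0 ord0))%N &
      coprime (u ord0) (u (lift ord0 ord0))].

(** A coprime pair fills the first two entries and the other [m] entries are free. *)
Lemma coprime_vec_count N U : (U <= N)%N ->
  (U ^ m.+2 <= 8 * #|[set u : {ffun 'I_m.+2 -> 'I_N.+1} |
    coprime_vec [ffun i => nat_of_ord (u i)] & [forall i, (u i <= U)%N]]|.+1)%N.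
Proof.
move=> UN; set A := [set _ | _ & _].
pose B := [set ab : 'I_U * 'I_U | coprime ab.1.+1 ab.2.+1]%SET.
have cardB : (U ^ 2 <= 2 * #|B|)%N.
  apply: (leq_trans (coprime_pairs_ge U)); rewrite leq_mul2l/=.
  rewrite pair_bigA/= -sum1_card [leqRHS]big_mkcond; apply: leq_sum => -[a b] _.
  by rewrite inE/=; case: coprime.
pose f (x : ('I_U * 'I_U) * {ffun 'I_m -> 'I_U.+1}) : {ffun 'I_m.+2 -> 'I_N.+1}
  :=
  [ffun i : 'I_m.+2 => match nat_of_ord i with
    | 0 => inord x.1.1.+1 | 1 => inord x.1.2.+1
    | j.+2 => if insub j is Some j' then inord (x.2 j') else ord0 end].
have f0 x : f x ord0 = x.1.1.+1 :> nat.
  by rewrite ffunE /= inordK// ltnS (leq_trans _ UN).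
have f1 x : f x (lift ord0 ord0) = x.1.2.+1 :> nat.
  by rewrite ffunE /= inordK// ltnS (leq_trans _ UN).
have f2 x (j : 'I_m) : f x (lift ord0 (lift ord0 j)) = x.2 j :> nat.
  rewrite ffunE /= insubT ?ltn_ord//= => jm; rewrite inordK.
    by congr (nat_of_ord (x.2 _)); exact: val_inj.
  by rewrite (leq_trans (ltn_ord _))// ltnS.
have finj : injective f.
  move=> [[a b] w] [[a' b'] w'] e.
  have := f0 ((a, b), w); rewrite e f0 /= => -[ea].
  have := f1 ((a, b), w); rewrite e f1 /= => -[eb].
  have -> : w = w'.
    apply/ffunP => j; apply/val_inj => /=.
    by have := f2 ((a, b), w) j; rewrite e f2.
  by congr ((_, _), _); apply/val_inj.
have : (#|finset.setX B [set: {ffun 'I_m -> 'I_U.+1}]%SET| <= #|A|)%N.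
  rewrite -(card_imset _ finj); apply: subset_leq_card;
    apply/fintype.subsetP => u.
  move=> /imsetP[[[a b] w]]; rewrite !inE/= andbT => cab ->; apply/andP; split.
    set x := (a, b, w).
    have E i : [ffun i => nat_of_ord (f x i)] i = f x i by rewrite [LHS]ffunE.
    by rewrite /coprime_vec !E f0 f1.
  apply/forallP => i; case: (unliftP ord0 i) => [i' ->|->];
    last by rewrite f0/=.
  case: (unliftP ord0 i') => [j ->|->]; last by rewrite f1/=.
  by rewrite f2/= -ltnS.
rewrite cardsX cardsT card_ffun !card_ord => h.
have -> : (U ^ m.+2 = U ^ 2 * U ^ m)%N by rewrite -expnD.
have h2 : (U ^ m <= U.+1 ^ m)%N by elim: (m) => // k ih; rewrite !expnS leq_mul.
apply: leq_trans (leq_mul cardB h2) _; rewrite -mulnA.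
by apply: (leq_trans (leq_mul (leqnn 2) h)); lia.
Qed.

Lemma liminf_hit_prob_le_planar (theta : nat -> R) (K : nat) :
  (forall k, 0 < theta k) ->
  (forall M, exists L, M < \sum_(0 <= k < L) (theta k * 2 ^+ (n * k))^-1) ->
  P (\bigcap_(k in [set k | (K <= k)%N]) @hit R m.+2 n k (theta k)) <=
  1 - (1 + 4 * 128 ^+ n)^-1.
Proof.
have cN d := @measurable_near_int R d; have pN d := @periodic1_near_int R d.
have mC : measurable (~` near_int (4^-1) : set (measurableTypeR R)) by exact:
  measurableC.
have pC : periodic1 (~` near_int (4^-1) : set R).
  by move=> x a; split => h h'; apply: h; apply/(pN _ x a).
apply: (@liminf_hit_prob_le R m.+2 n isT n_gt0 coprime_vec
  (fun u d => col_event (near_int d) (fun i => Posz (u i)) `&`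
              vec_event (~` near_int (4^-1)) (fun i => Posz (u i)))).
- by move=> N U; exact: coprime_vec_count.
- by move=> u d; apply: measurableI; [exact: measurable_col_event|exact:
  measurable_vec_event].
- move=> u d /and3P[u0 _ _] d0 d1.
  rewrite (@prob_col_vec_event R m.+2 n _ (2 * d) _ (2^-1))//.
  + rewrite ler_pM2r// lerXn2r ?nnegrE ?divr_ge0 ?mulr_ge0 ?ltW//; lra.
  + by apply: circle_near_int; lra.
  + exact: circle_not_near_int.
  + by exists ord0; rewrite eqz_nat -lt0n.
- move=> u u' d d' /and3P[u0 u1 uc] /and3P[u0' u1' uc'] uu' d0 d1 d0' d1'.
  (* For the upper bound the conditions on [b] are dropped, which costs only a constant factor. *)
  apply: le_trans (_ : P (col_event (near_int d) (fun i => Posz (u i)) `&`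
      @col_event R m.+2 n (near_int d') (fun i => Posz (u' i))) <= _).
    apply: le_torus_prob.
    + by do 2 apply: measurableI; by [exact: measurable_col_event|exact:
      measurable_vec_event].
    + by apply: measurableI; exact: measurable_col_event.
    + by move=> z [[? _] [? _]].
  rewrite (@prob_col_eventI R m.+2 n _ (2 * d) _ (2 * d'))//.
  + by rewrite -exprMn lerXn2r ?nnegrE ?mulr_ge0 ?ltW//; nra.
  + by apply: circle_near_int; lra.
  + by apply: circle_near_int; lra.
  + set i1 := lift ord0 ord0 in u1 uc u1' uc'.
    (* If the minor on the first two entries vanishes, coprimality forces [u] and [u'] to share
       their positive first entry; any index where they differ then gives a nonzero minor with
       it. *)
    have [e|ne] := eqVneq (u ord0 * u' i1)%N (u i1 * u' ord0)%N; last first.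
      by exists ord0, i1; rewrite -!PoszM eqz_nat.
    have e0 : u ord0 = u' ord0.
      apply/eqP; rewrite eqn_dvd; apply/andP; split.
        by rewrite -(Gauss_dvdr _ uc) -e dvdn_mulr.
      by rewrite coprime_sym in uc'; rewrite -(Gauss_dvdl _ (etrans
        (coprime_sym _ _) uc')) e dvdn_mull.
    have [i ui] : exists i, u i != u' i.
      apply/existsP; apply: contraNT uu'; rewrite negb_exists => /forallP h.
      by apply/eqP/ffunP => i; have := h i; rewrite negbK => /eqP.
    exists ord0, i; rewrite -!PoszM eqz_nat [X in _ != X]mulnC -e0 eqn_pmul2l//.
    by rewrite eq_sym.
- by move=> u d z.
Qed.

End planar.
Section linear.
Variable n : nat.
Hypothesis n_gt0 : (0 < n)%N.

Definition dense_den (u : {ffun 'I_1 -> nat}) :=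
  (1 < u ord0)%N && (u ord0 <= 8 * totient (u ord0))%N.

(** The additional [1] pays for the denominator [1], which [dense_totient] counts and [dense_den]
    excludes. *)
Lemma dense_den_count N U : (U <= N)%N ->
  (U ^ 1 <= 8 * #|[set u : {ffun 'I_1 -> 'I_N.+1} |
    dense_den [ffun i => nat_of_ord (u i)] & [forall i, (u i <= U)%N]]|.+1)%N.
Proof.
move=> UN; rewrite expn1; set A := [set _ | _ & _].
apply: (leq_trans (dense_totient U)); rewrite leq_mul2l/=.
pose B := [set a : 'I_U | (0 < a)%N & (a.+1 <= 8 * totient a.+1)%N].
have h1 : (\sum_(a < U) (a.+1 <= 8 * totient a.+1) <= #|B|.+1)%N.
  case: U UN @B {A} => [|U] UN B; first by rewrite big_ord0.
  rewrite big_ord_recl -[X in (_ <= X)%N]add1n; apply: leq_add;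
    first exact: leq_b1.
  rewrite -sum1_card [leqRHS]big_mkcond big_ord_recl/= addnC.
  apply: leq_trans (leq_addr _ _); apply: leq_sum => a _.
  by rewrite inE; case: ifP => //; rewrite lift0 /= => ->.
apply: (leq_trans h1); rewrite ltnS.
pose f (a : 'I_U) : {ffun 'I_1 -> 'I_N.+1} := [ffun=> inord a.+1].
have fE a i : f a i = a.+1 :> nat.
  by rewrite ffunE inordK// ltnS (leq_trans (ltn_ord a)).
have finj : injective f.
  by move=> a a' e; apply/val_inj; have := fE a ord0; rewrite e fE => -[].
rewrite -(card_imset _ finj); apply: subset_leq_card;
  apply/fintype.subsetP => u.
move=> /imsetP[a]; rewrite !inE => /andP[a0 a1] ->; apply/andP; split.
  have E i : [ffun i => nat_of_ord (f a i)] i = f a i by rewrite [LHS]ffunE.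
  by rewrite /dense_den !E fE ltnS a0.
by apply/forallP => i; rewrite fE.
Qed.

Let not_near (u : nat) : set R := [set t | ~ near_int (4^-1) (t * u%:R)].

Let measurable_not_near u : measurable (not_near u : set (measurableTypeR R)).
Proof.
apply: measurableC; rewrite -[X in measurable X]setTI.
have mf : measurable_fun setT (fun x : measurableTypeR R => x * u%:R :
  measurableTypeR R).
  exact: measurable_funM.
exact: (mf measurableT _ (measurable_near_int _)).
Qed.

Let prob_box (B C : set R) :
  measurable (B : set (measurableTypeR R)) ->
  measurable (C : set (measurableTypeR R)) ->
  P [set z : space R (1 * n) 1 | (forall k, B (coord z (inl k))) /\ C (coord z
    (inr ord0))]
  = fine (mu (`[0%R, 1%R[%classic `&` B)) ^+ n * fine (mu (`[0%R, 1%R[%classic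
    `&` C)).
Proof.
move=> mB mC; rewrite /torus_prob.
pose A (i : 'I_(1 * n) + 'I_1) := match i with inl _ => B | inr _ => C end.
have -> : [set z : space R (1 * n) 1 | (forall k, B (coord z (inl k))) /\ C
  (coord z (inr ord0))]
   = [set z | forall i, A i (coord z i)].
  apply/seteqP; split => z.
    by move=> [h1 h2] [k|i] /=; [exact: h1|rewrite (ord1 i)].
  by move=> h; split; [move=> k; exact: (h (inl k))|exact: (h (inr ord0))].
rewrite lam_ucube_coord_box; last by case.
rewrite (eq_bigr (fun i => (match i with inl _ => fine (mu (`[0%R, 1%R[%classic
  `&` B))
   | inr _ => fine (mu (`[0%R, 1%R[%classic `&` C)) end)%:E)); last first.
  by case=> i _ /=; rewrite fineK//; exact: unit_itv_fin.
by rewrite prode_EFin/= big_sumType/= big_ord1 prodr_const card_ord mul1n.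
Qed.

Let vec_form1 (z : space R (1 * n) 1) (u : {ffun 'I_1 -> nat}) :
  vec_form z (fun i => Posz (u i)) = coord z (inr ord0) * (u ord0)%:R.
Proof. by rewrite /vec_form big_ord1. Qed.

Let col_form1 (z : space R (1 * n) 1) (u : {ffun 'I_1 -> nat}) j :
  col_form z (fun i => Posz (u i)) j = coord z (inl (mxvec_index ord0 j)) * (u
    ord0)%:R.
Proof. by rewrite /col_form big_ord1. Qed.

(** Multiplication by [u] preserves the measure of the circle. This is read off from
    [prob_col_vec_event] with the trivial condition on the columns. *)
Let measure_not_near (u : {ffun 'I_1 -> nat}) : (0 < u ord0)%N ->
  fine (mu (`[0%R, 1%R[%classic `&` not_near (u ord0))) = 2^-1.
Proof.
move=> u0.
have mC : measurable (~` near_int (4^-1) : set (measurableTypeR R)).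
  by apply: measurableC; exact: measurable_near_int.
have pC : periodic1 (~` near_int (4^-1) : set R).
  by move=> x a; split => h h'; apply: h; apply/(periodic1_near_int _ x a).
have := @prob_col_vec_event R 1 n setT 1 _ (2^-1) (fun i => Posz (u i))
  measurableT
  (fun _ _ => conj id id) mu_unit_itv mC pC circle_not_near_int.
rewrite expr1n mul1r => <-; last by exists ord0; rewrite eqz_nat -lt0n.
have -> : col_event setT (fun i => Posz (u i)) `&`
    vec_event (~` near_int (4^-1)) (fun i => Posz (u i)) =
    [set z : space R (1 * n) 1 | (forall k, setT (coord z (inl k))) /\
      not_near (u ord0) (coord z (inr ord0))].
  by apply/seteqP; split => z [_ h]; split => //; move: h;
    rewrite /vec_event /= ?vec_form1.
by rewrite prob_box// mu_unit_itv expr1n mul1r.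
Qed.

Lemma liminf_hit_prob_le_linear (theta : nat -> R) (K : nat) :
  (forall k, 0 < theta k) ->
  (forall M, exists L, M < \sum_(0 <= k < L) (theta k * 2 ^+ (n * k))^-1) ->
  P (\bigcap_(k in [set k | (K <= k)%N]) @hit R 1 n k (theta k)) <=
  1 - (1 + 4 * 128 ^+ n)^-1.
Proof.
(* With a single row [A^T u] is [u A], so the conditions concern separate independent entries and
   probabilities are [n]-th powers of one-dimensional measures. *)
pose G (u : {ffun 'I_1 -> nat}) (d : R) : set (space R (1 * n) 1) :=
  [set z | (forall k, red_near (u ord0) d (coord z (inl k))) /\
           not_near (u ord0) (coord z (inr ord0))].
have mG u d : measurable (G u d).
  apply: measurableI.
    by apply: measurable_forall => k; exact: (measurable_coord_preimage _
      (measurable_red_near _ _)).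
  exact: (measurable_coord_preimage _ (measurable_not_near _)).
apply: (@liminf_hit_prob_le R 1 n isT n_gt0 dense_den G) => //.
- by move=> N U; exact: dense_den_count.
- move=> u d /andP[u1 ut] d0 d1.
  rewrite prob_box//; last exact: measurable_red_near.
  rewrite measure_not_near; last exact: ltnW.
  have d2 : d <= 2^-1 by lra.
  rewrite ler_pM2r//; apply: lerXn2r; rewrite ?nnegrE.
  - by rewrite divr_ge0// ltW.
  - by rewrite fine_ge0// measure_ge0.
  have := measure_red_near_ge u1 d0 d2.
  rewrite -[X in (_ <= X)%E]fineK ?unit_itv_fin//;
    last exact: measurable_red_near.
  rewrite lee_fin => h; apply: le_trans h.
  have u0' : 0 < (u ord0)%:R :> R by rewrite ltr0n ltnW.
  have ut' : (u ord0)%:R <= 8 * (totient (u ord0))%:R :> R by rewrite -natrM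
    ler_nat.
  rewrite ler_pdivlMr//.
  have : d / 4 * (u ord0)%:R <= d / 4 * (8 * (totient (u ord0))%:R) :> R.
    by rewrite ler_pM2l// divr_gt0.
  by move=> /le_trans; apply; rewrite le_eqVlt; apply/orP; left; apply/eqP;
    field.
- move=> u u' d d' /andP[u1 _] /andP[u1' _] uu' d0 d1 d0' d1'.
  have mR : measurable (red_near (u ord0) d `&` red_near (u' ord0) d' : set
    (measurableTypeR R)).
    by apply: measurableI; exact: measurable_red_near.
  apply: le_trans (_ : P [set z : space R (1 * n) 1 |
      (forall k, (red_near (u ord0) d `&` red_near (u' ord0) d') (coord z (inl
        k))) /\
      setT (coord z (inr ord0))] <= _).
    apply: le_torus_prob.
    + exact: measurableI.
    + apply: measurableI; last exact: (measurable_coord_preimage _ measurableT).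
      by apply: measurable_forall => k; exact: (measurable_coord_preimage _ mR).
    + by move=> z [[h _] [h' _]].
  rewrite prob_box// mu_unit_itv mulr1; apply: lerXn2r; rewrite ?nnegrE.
  - by rewrite fine_ge0// measure_ge0.
  - by rewrite !mulr_ge0// ltW.
  rewrite -lee_fin fineK ?unit_itv_fin//; apply: measure_red_nearI_le => //;
    try lra.
  by apply: contra uu' => /eqP e; apply/eqP/ffunP => i; rewrite (ord1 i).
- move=> u d z [h1 h2]; split; last by rewrite /vec_event /= vec_form1.
  by move=> j; rewrite col_form1; have [p [_ hp]] := h1 (mxvec_index ord0 j);
    exists p.
Qed.

End linear.
End divergence_instances.

(** * From a uniform bound to probability zero *)

Section liminf.
Context {R : realType}.
Local Notation P := torus_prob.

Lemma liminf_hit_prob_le_gen (m n : nat) (theta : nat -> R) (K : nat) :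
  (0 < m)%N -> (0 < n)%N -> (forall k, 0 < theta k) ->
  (forall M, exists L, M < \sum_(0 <= k < L) (theta k * 2 ^+ (n * k))^-1) ->
  P (\bigcap_(k in [set k | (K <= k)%N]) @hit R m n k (theta k)) <=
  1 - (1 + 4 * 128 ^+ n)^-1.
Proof.
case: m => [//|[|m]] _ n0; first exact: liminf_hit_prob_le_linear.
exact: liminf_hit_prob_le_planar.
Qed.

Lemma row_form_dilate m n p (z : space R (m * n) m) q i :
  row_form (dilate p z) q i = 2 ^+ p * row_form z q i.
Proof.
rewrite /row_form coordK mulrDr; congr (_ + _); rewrite mulr_sumr.
by apply: eq_bigr => j _; rewrite coordK mulrA.
Qed.

Lemma hit_dilate m n k (theta : R) z :
  @hit R m n k theta z -> hit k (2 ^+ m * theta) (dilate 1 z).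
Proof.
move=> [q [q1 q2]]; exists q; split => // i; have [p hp] := q2 i.
exists (2 * p); rewrite row_form_dilate expr1 intrM -mulrBr normrM exprMn.
by rewrite ger0_norm// ltr_pM2l// exprn_gt0.
Qed.

Lemma periodic_bigcup k l (I : Type) (D : set I) (F : I -> set (space R k l)) :
  (forall i, periodic (F i)) -> periodic (\bigcup_(i in D) F i).
Proof.
by move=> pF z a; split => -[i Di h]; exists i => //; exact/(pF i z a).
Qed.

Lemma periodic_bigcap k l (I : Type) (D : set I) (F : I -> set (space R k l)) :
  (forall i, periodic (F i)) -> periodic (\bigcap_(i in D) F i).
Proof.
by move=> pF z a; split => h i Di; apply/(pF i z a); exact: h.
Qed.

Lemma periodicC k l (A : set (space R k l)) : periodic A -> periodic (~` A).
Proof. by move=> pA z a; split => h h'; apply: h; exact/(pA z a). Qed.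

Lemma liminf_hit_prob0 (m n : nat) (theta : nat -> R) :
  (0 < m)%N -> (0 < n)%N -> (forall k, 0 < theta k) ->
  (forall M, exists L, M < \sum_(0 <= k < L) (theta k * 2 ^+ (n * k))^-1) ->
  P (\bigcup_K \bigcap_(k in [set k | (K <= k)%N]) @hit R m n k (theta k)) = 0.
Proof.
move=> m0 n0 t0 tdiv.
pose H l := \bigcup_K \bigcap_(k in [set k | (K <= k)%N])
  @hit R m n k (2 ^+ m ^+ l * theta k).
have mcap l K : measurable (\bigcap_(k in [set k | (K <= k)%N])
    @hit R m n k (2 ^+ m ^+ l * theta k)).
  by apply: bigcap_measurable => [|k _]; [exists K => /=|exact: measurable_hit].
have mH l : measurable (H l) by exact: bigcupT_measurable.
have pow0 l : 0 < 2 ^+ m ^+ l :> R by rewrite !exprn_gt0.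
(* Multiplying [theta] by a constant keeps the series divergent, so the same bound holds for every
   [l] and passes to the increasing union [S]. *)
have Hle l : P (H l) <= 1 - (1 + 4 * 128 ^+ n)^-1.
  apply: torus_prob_bigcup_le.
  - exact: mcap.
  - by move=> K z h k Kk; apply: h; exact: ltnW.
  - move=> K; apply: liminf_hit_prob_le_gen => //; first by move=> k;
    rewrite mulr_gt0.
    move=> M; have [L hL] := tdiv (2 ^+ m ^+ l * M); exists L.
    under eq_bigr do rewrite -mulrA invfM.
    by rewrite -mulr_sumr -ltr_pdivrMl ?invr_gt0// invrK.
pose S := \bigcup_l H l.
have mS : measurable S by exact: bigcupT_measurable.
have Hnd l : H l `<=` H l.+1.
  move=> z [K _ h]; exists K => // k Kk; apply: hit_le (h k Kk).
  rewrite ler_pM2r// [leRHS]exprS; apply: ler_peMl; first exact: ltW.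
  by rewrite exprn_ege1// ler1n.
have Sle : P S <= 1 - (1 + 4 * 128 ^+ n)^-1 by exact: torus_prob_bigcup_le.
have S0 : P S = 0.
  apply: zero_one => //.
  - apply: periodic_bigcup => l; apply: periodic_bigcup => K.
    by apply: periodic_bigcap => k; exact: periodic_hit.
  - move=> z [l _ [K _ h]]; exists l.+1 => //; exists K => // k Kk.
    by rewrite exprS -mulrA; apply: hit_dilate; exact: h.
  - by apply: (le_lt_trans Sle); rewrite ltrBlDr ltrDl invr_gt0 addr_gt0.
rewrite (_ : \bigcup_K _ = H 0%N); last first.
  by apply: eq_bigcupr => K _; apply: eq_bigcapr => k _; rewrite expr0 mul1r.
apply/eqP; rewrite eq_le torus_prob_ge0 andbT -S0; apply: le_torus_prob => //.
by move=> z hz; exists 0%N.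
Qed.

End liminf.

(** * Cauchy condensation along the scales [2^(n k)] *)

Section condensation.
Context {R : realType}.
Variables (n : nat) (T0 : R) (psi : R -> R).
Hypotheses (n_gt0 : (0 < n)%N) (T0_gt1 : 1 < T0)
  (psi_gt0 : forall T : R, T0 <= T -> 0 < psi T)
  (psi_nincr : forall S T : R, T0 <= S -> S <= T -> psi T <= psi S).

(** The maximum keeps the argument in the domain where [psi] is positive and monotone. *)
Definition dyadic_psi k := psi (Num.max T0 (2 ^+ (n * k))).

Lemma dyadic_psi_gt0 k : 0 < dyadic_psi k.
Proof. by apply: psi_gt0; rewrite le_max lexx. Qed.

Let f (j : nat) : R := if T0 <= j%:R then (psi j%:R * j%:R ^+ 2)^-1 else 0.

Let f_ge0 j : 0 <= f j.
Proof.
rewrite /f; case: ifP => // h; rewrite invr_ge0 mulr_ge0 ?sqr_ge0//.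
exact/ltW/psi_gt0.
Qed.

Let seriesE N : inv_psi_series T0 psi N = \sum_(0 <= j < N) f j.
Proof. by rewrite /inv_psi_series big_mkcond. Qed.

Let series_nd : nondecreasing_seq (inv_psi_series T0 psi).
Proof.
apply/nondecreasing_seqP => N; rewrite !seriesE big_nat_recr//= lerDl.
exact: f_ge0.
Qed.

Let block_sum a b : (a <= b)%N ->
  \sum_(2 ^ (n * a) <= j < 2 ^ (n * b)) f j =
  \sum_(a <= k < b) \sum_(2 ^ (n * k) <= j < 2 ^ (n * k.+1)) f j.
Proof.
elim: b => [|b ih]; first by rewrite leqn0 => /eqP ->; rewrite !big_geq.
rewrite leq_eqVlt => /orP[/eqP <-|]; first by rewrite !big_geq.
rewrite ltnS => ab; rewrite big_nat_recr//= -ih//.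
by rewrite (big_cat_nat (n := 2 ^ (n * b)))//= leq_exp2l// leq_mul2l ?ab
  ?leqnSn orbT.
Qed.

Let pow_leS k : (2 ^ (n * k) <= 2 ^ (n * k.+1))%N.
Proof. by rewrite leq_exp2l// leq_mul2l leqnSn orbT. Qed.

(** The block has at least [2 ^ (n (k + 1))] indices, each below [2 ^ (n (k + 2))]. On the left
    [psi] is taken one scale further than the power, as the convergence half requires; the factor
    [2 ^ (3 n)] absorbs this. *)
Lemma block_lower k : T0 <= 2 ^+ (n * k.+1) ->
  (dyadic_psi k.+1 * 2 ^+ (n * k))^-1 <=
  2 ^+ (n * 3) * \sum_(2 ^ (n * k.+1) <= j < 2 ^ (n * k.+2)) f j.
Proof.
move=> Tk.
have maxE : dyadic_psi k.+1 = psi (2 ^+ (n * k.+1)).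
  by rewrite /dyadic_psi; congr psi; apply/max_idPr.
have p0 : 0 < psi (2 ^+ (n * k.+1)) by exact: psi_gt0.
have e0 j : 0 < 2 ^+ j :> R by rewrite exprn_gt0.
apply: le_trans (_ : 2 ^+ (n * 3) * \sum_(2 ^ (n * k.+1) <= j < 2 ^ (n * k.+2))
   (psi (2 ^+ (n * k.+1)) * (2 ^+ (n * k.+2)) ^+ 2)^-1 <= _); last first.
  rewrite ler_pM2l// big_nat [leRHS]big_nat; apply: ler_sum => j /andP[j1 j2].
  have jR : 2 ^+ (n * k.+1) <= j%:R :> R by rewrite -natrX ler_nat.
  have Tj : T0 <= j%:R by exact: le_trans jR.
  have j0 : 0 < j%:R :> R by exact: lt_le_trans jR.
  rewrite /f Tj lef_pV2 ?posrE ?mulr_gt0 ?exprn_gt0 ?psi_gt0//.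
  apply: ler_pM; rewrite ?exprn_ge0//; first exact/ltW/psi_gt0.
    exact: psi_nincr.
  by rewrite lerXn2r ?nnegrE// -natrX ler_nat ltnW.
rewrite sumr_const_nat -[X in _ <= _ * X]mulr_natl maxE.
have cnt : 2 ^+ (n * k.+1) <= (2 ^ (n * k.+2) - 2 ^ (n * k.+1))%:R :> R.
  have : 2 * 2 ^+ (n * k.+1) <= 2 ^+ (n * k.+2) :> R.
    by rewrite -exprS ler_weXn2l ?ler1n// [(n * k.+2)%N]mulnS; lia.
  by rewrite natrB ?pow_leS// !natrX => h; lra.
apply: le_trans (_ : 2 ^+ (n * 3) * (2 ^+ (n * k.+1) *
   (psi (2 ^+ (n * k.+1)) * (2 ^+ (n * k.+2)) ^+ 2)^-1) <= _); last first.
  by rewrite ler_pM2l// ler_pM2r// invr_gt0 mulr_gt0// exprn_gt0.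
rewrite le_eqVlt; apply/orP; left; apply/eqP.
have -> : (2 ^+ (n * k.+2)) ^+ 2 = 2 ^+ (n * 3) * 2 ^+ (n * k.+1) * 2 ^+ (n *
  k) :> R.
  by rewrite -exprM -!exprD; congr (_ ^+ _); lia.
have nz j : 2 ^+ j != 0 :> R by rewrite gt_eqF.
by field; rewrite !nz gt_eqF.
Qed.

(** On the block [psi] is at least its value at the right end, [j] is at least the left end, and
    there are at most [2 ^ (n (k + 1))] indices. *)
Lemma block_upper k :
  \sum_(2 ^ (n * k) <= j < 2 ^ (n * k.+1)) f j <=
  2 ^+ (n * 2) * (dyadic_psi k.+1 * 2 ^+ (n * k.+1))^-1.
Proof.
have e0 j : 0 < 2 ^+ j :> R by rewrite exprn_gt0.
have p0 := dyadic_psi_gt0 k.+1.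
apply: le_trans (_ : \sum_(2 ^ (n * k) <= j < 2 ^ (n * k.+1))
   (dyadic_psi k.+1 * (2 ^+ (n * k)) ^+ 2)^-1 <= _).
  rewrite big_nat [leRHS]big_nat; apply: ler_sum => j /andP[j1 j2].
  have jR : 2 ^+ (n * k) <= j%:R :> R by rewrite -natrX ler_nat.
  have j0 : 0 < j%:R :> R by exact: lt_le_trans jR.
  rewrite /f; case: ifP => [Tj|_]; last first.
    by rewrite invr_ge0 mulr_ge0 ?exprn_ge0// ltW.
  rewrite lef_pV2 ?posrE ?mulr_gt0 ?exprn_gt0 ?psi_gt0//;
    last by rewrite le_max lexx.
  apply: ler_pM; rewrite ?exprn_ge0//; first exact: ltW.
    apply: psi_nincr => //; rewrite le_max; apply/orP; right.
    by rewrite -natrX ler_nat ltnW.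
  by rewrite lerXn2r ?nnegrE// ltW.
rewrite sumr_const_nat -[leLHS]mulr_natl.
apply: le_trans (_ : 2 ^+ (n * k.+1) * (dyadic_psi k.+1 * (2 ^+ (n * k)) ^+
  2)^-1 <= _).
  rewrite ler_pM2r; last by rewrite invr_gt0 mulr_gt0// exprn_gt0.
  by rewrite natrB ?pow_leS// !natrX lerBlDr lerDl ltW.
rewrite le_eqVlt; apply/orP; left; apply/eqP.
have -> : 2 ^+ (n * k.+1) = 2 ^+ n * 2 ^+ (n * k) :> R by rewrite mulnS exprD.
have -> : 2 ^+ (n * 2) = 2 ^+ n ^+ 2 :> R by rewrite exprM.
have nz j : 2 ^+ j != 0 :> R by rewrite gt_eqF.
by field; rewrite !nz gt_eqF.
Qed.

Lemma condensation_cvg : cvg (inv_psi_series T0 psi @ \oo) ->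
  exists M, forall N, \sum_(0 <= k < N) (dyadic_psi k.+1 * 2 ^+ (n * k))^-1 <=
    M.
Proof.
move=> cv; set g := fun k => (dyadic_psi k.+1 * 2 ^+ (n * k))^-1.
have g0 k : 0 <= g k by rewrite invr_ge0 mulr_ge0 ?exprn_ge0// ltW//
  dyadic_psi_gt0.
(* From [k0] on the scales exceed [T0] and [block_lower] applies; the finitely many earlier terms go
   into the bound. *)
pose k0 := Num.bound T0.
have Tk k : (k0 <= k)%N -> T0 <= 2 ^+ (n * k.+1).
  move=> kk; have T00 : 0 <= T0 by rewrite ltW// (lt_trans ltr01).
  apply: (le_trans (ltW (archi_boundP T00))).
  rewrite -natrX ler_nat (leq_trans kk)// ltnW// (leq_trans (ltn_expl k (ltnSn
    1)))//.
  by rewrite leq_exp2l//; nia.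
exists (\sum_(0 <= k < k0) g k + 2 ^+ (n * 3) * lim (inv_psi_series T0 psi @
  \oo)) => N.
apply: le_trans (_ : \sum_(0 <= k < k0 + N) g k <= _).
  by rewrite [leRHS](big_cat_nat (n := N))//= ?leq_addl// lerDl sumr_ge0.
rewrite (big_cat_nat (n := k0))//= ?leq_addr// lerD2l.
apply: le_trans (_ : 2 ^+ (n * 3) * inv_psi_series T0 psi (2 ^ (n * (k0 +
  N).+1))%N <= _); last first.
  by rewrite ler_pM2l ?exprn_gt0//; exact: nondecreasing_cvgn_le.
rewrite seriesE.
apply: le_trans (_ : 2 ^+ (n * 3) * \sum_(2 ^ (n * k0.+1) <= j < 2 ^ (n * (k0 +
  N).+1)) f j <= _); last first.
  rewrite ler_pM2l ?exprn_gt0// [leRHS](big_cat_nat (n := 2 ^ (n * k0.+1)))//=.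
    by rewrite lerDr sumr_ge0.
  by rewrite leq_exp2l// leq_mul2l ltnS leq_addr orbT.
rewrite block_sum ?ltnS ?leq_addr// mulr_sumr [leRHS]big_add1/=.
rewrite big_nat [leRHS]big_nat; apply: ler_sum => k /andP[kk _].
by apply: block_lower; exact: Tk.
Qed.

Lemma condensation_div : ~ cvg (inv_psi_series T0 psi @ \oo) ->
  forall M, exists L, M < \sum_(0 <= k < L) (dyadic_psi k * 2 ^+ (n * k))^-1.
Proof.
move=> ncv M; apply: contrapT => hM; apply: ncv.
have {}hM L : \sum_(0 <= k < L) (dyadic_psi k * 2 ^+ (n * k))^-1 <= M.
  by rewrite leNgt; apply/negP => h; apply: hM; exists L.
apply: nondecreasing_is_cvgn; first exact: series_nd.
exists (2 ^+ (n * 2) * M) => _ [N _ <-].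
apply: le_trans (_ : inv_psi_series T0 psi (2 ^ (n * N))%N <= _).
  apply: series_nd; rewrite (leq_trans (ltnW (ltn_expl N (ltnSn 1))))//
    leq_exp2l//.
  exact: leq_pmull.
rewrite seriesE (big_cat_nat (n := 1))//= ?expn_gt0//.
(* The index [0] lies in no dyadic block; its term is zero because [T0] is positive. *)
rewrite big_nat1 {1}/f ifF ?add0r; last by apply/negbTE;
  rewrite -ltNge (lt_trans ltr01).
have -> : \sum_(1 <= j < 2 ^ (n * N)) f j = \sum_(2 ^ (n * 0) <= j < 2 ^ (n *
  N)) f j.
  by rewrite muln0 expn0.
rewrite block_sum//.
apply: le_trans (_ : \sum_(0 <= k < N) 2 ^+ (n * 2) * (dyadic_psi k.+1 * 2 ^+
  (n * k.+1))^-1 <= _).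
  by apply: ler_sum => k _; exact: block_upper.
rewrite -mulr_sumr ler_pM2l ?exprn_gt0//; apply: le_trans (hM N.+1).
rewrite big_nat_recl//= lerDr invr_ge0 mulr_ge0 ?exprn_ge0// ltW//.
exact: dyadic_psi_gt0.
Qed.

End condensation.

(** * The sets of uniformly approximable pairs *)

Section uniform_approximation.
Context {R : realType}.
Variables (m n : nat) (T0 : R) (psi : R -> R).
Hypotheses (m_gt0 : (0 < m)%N) (n_gt0 : (0 < n)%N).

Lemma cV_norm_expr_lt k e (v : 'cV[R]_k) (t : R) : (0 < k)%N -> (0 < e)%N ->
  (`|v| ^+ e < t) <-> (forall i, `|v i ord0| ^+ e < t).
Proof.
move=> k0 e0.
have nE : `|v| = mx_norm v by [].
have le i : `|v i ord0| <= `|v|.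
  by rewrite nE mx_normrE; exact: (le_bigmax _ (fun ij : 'I_k * 'I_1 => `|v
    ij.1 ij.2|) (i, ord0)).
split => [h i|h].
  by apply: le_lt_trans h; rewrite lerXn2r ?nnegrE.
have [v0|/mx_norm_neq0[[i j] ij]] := eqVneq (mx_norm v) 0.
  by apply: le_lt_trans (h (Ordinal k0));
    rewrite nE v0 expr0n eqn0Ngt e0 exprn_ge0.
by rewrite nE ij /= (ord1 j); exact: h.
Qed.

Lemma Dhat_entry (z : space R (m * n) m) (p : 'cV[int]_m) (q : 'cV[int]_n) i :
  (mx_of_tuple z.1 *m map_mx intr q + cV_of_tuple z.2 - map_mx intr p) i ord0 =
  row_form z (fun j => q j ord0) i - (p i ord0)%:~R.
Proof.
by rewrite !mxE; congr (_ + _ - _); apply: eq_bigr => j _; rewrite !mxE.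
Qed.

Let Dhat_space : set (space R (m * n) m) :=
  [set z | @Dhat R m n T0 psi (mx_of_tuple z.1, cV_of_tuple z.2)].

(** Evaluate at [T = 2 ^ (n k)]: these heights are chosen because [|q| ^ n < T] then becomes the box
    condition [|q| < 2 ^ k]. *)
Lemma Dhat_sub_liminf_hit : Dhat_space `<=`
  \bigcup_K \bigcap_(k in [set k | (K <= k)%N]) @hit R m n k (dyadic_psi n T0
    psi k).
Proof.
move=> z [T1 T01 hT]; exists (Num.bound T1) => // k /= Kk.
have T1k : T1 <= 2 ^+ (n * k).
  by apply/ltW/upper_nthrootP; exact: leq_trans Kk (leq_pmull _ n_gt0).
have [p [q [hp hq]]] := hT _ T1k.
exists [ffun j => q j ord0]; split.
  move=> j; rewrite ffunE -(ltr_int R) intr_norm rmorphXn/=.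
  move: hq => /(cV_norm_expr_lt _ _ n_gt0 n_gt0)/(_ j); rewrite mxE mulnC exprM.
  by rewrite ltr_pXn2r ?nnegrE.
move=> i; exists (p i ord0).
move: hp => /(cV_norm_expr_lt _ _ m_gt0 m_gt0)/(_ i); rewrite Dhat_entry.
rewrite /dyadic_psi (max_idPr (le_trans T01 T1k)).
suff -> : row_form z [ffun j => q j ord0] i = row_form z (fun j => q j ord0) i
  by [].
by rewrite /row_form; congr (_ + _); apply: eq_bigr => j _; rewrite ffunE.
Qed.

Hypothesis psi_nincr : forall S T : R, T0 <= S -> S <= T -> psi T <= psi S.

(** If [2 ^ (n k)] is the last scale not exceeding [T], a solution in the box of scale [k] respects
    [|q| ^ n < T], and monotonicity bounds [psi] at the next scale by [psi T]. This is the origin of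
    the shifted index. *)
Lemma setC_Dhat_sub_limsup_miss : ~` Dhat_space `<=`
  \bigcap_K \bigcup_(k in [set k | (K <= k)%N]) ~` @hit R m n k (dyadic_psi n
    T0 psi k.+1).
Proof.
move=> z; apply: contra_notP => /existsNP[K /not_implyP[_ hK]].
have {}hK k : (K <= k)%N -> @hit R m n k (dyadic_psi n T0 psi k.+1) z.
  by move=> Kk; apply: contrapT => h; apply: hK; exists k.
exists (Num.max T0 (2 ^+ (n * K))); first by rewrite le_max lexx.
move=> T; rewrite ge_max => /andP[T0T KT].
have ex : exists k : nat, 2 ^+ (n * k) <= T by exists K.
have ub k : 2 ^+ (n * k) <= T -> (k <= Num.bound T)%N.
  move=> kT; rewrite leqNgt; apply/negP => h.
  have : T < 2 ^+ (n * k).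
    by apply: upper_nthrootP; exact: leq_trans (ltnW h) (leq_pmull _ n_gt0).
  by rewrite ltNge kT.
case: (ex_maxnP ex ub) => k kT max.
have [q [q1 q2]] := hK k (max K KT).
have [p hp] := choice q2.
exists (\col_i p i), (\col_j q j); split.
  apply/(cV_norm_expr_lt _ _ m_gt0 m_gt0) => i; rewrite Dhat_entry mxE.
  have -> : row_form z (fun j => (\col_j q j) j ord0) i = row_form z q i.
    by rewrite /row_form; congr (_ + _); apply: eq_bigr => j _; rewrite mxE.
  apply: lt_le_trans (hp i) _; apply: psi_nincr => //.
  rewrite le_max; apply/orP; right; rewrite ltW// ltNge; apply/negP => /max.
  by rewrite ltnn.
apply/(cV_norm_expr_lt _ _ n_gt0 n_gt0) => j; rewrite !mxE.
apply: lt_le_trans kT; rewrite mulnC exprM ltr_pXn2r ?nnegrE//.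
by have := q1 j; rewrite -(ltr_int R) intr_norm rmorphXn.
Qed.

End uniform_approximation.

Theorem theorem1p6 (R : realType) (m n : nat) (T0 : R) (psi : R -> R)
    (m_gt0 : (0 < m)%N) (n_gt0 : (0 < n)%N) (T0_gt1 : 1 < T0)
    (psi_gt0 : forall T : R, T0 <= T -> 0 < psi T)
    (psi_nincr : forall S T : R, T0 <= S -> S <= T -> psi T <= psi S) :
  (lebesgue_null (@Dhat R m n T0 psi) <->
     ~ cvg (inv_psi_series T0 psi @ \oo)) /\
  (lebesgue_null (~` @Dhat R m n T0 psi) <->
     cvg (inv_psi_series T0 psi @ \oo)).
Proof.
have t0 := dyadic_psi_gt0 n psi_gt0.
have div : ~ cvg (inv_psi_series T0 psi @ \oo) -> lebesgue_null (@Dhat R m n T0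
  psi).
  move=> /(condensation_div n_gt0 T0_gt1 psi_gt0 psi_nincr) h.
  apply: negligibleS (Dhat_sub_liminf_hit m_gt0 n_gt0) _.
  apply: negligible_periodic.
  - apply: bigcupT_measurable => K; apply: bigcap_measurable => [|k _].
      by exists K => /=.
    exact: measurable_hit.
  - apply: periodic_bigcup => K; apply: periodic_bigcap => k;
    exact: periodic_hit.
  - exact: liminf_hit_prob0.
have conv : cvg (inv_psi_series T0 psi @ \oo) -> lebesgue_null (~` @Dhat R m n
  T0 psi).
  move=> /(condensation_cvg n_gt0 T0_gt1 psi_gt0 psi_nincr)[M h].
  apply: negligibleS (setC_Dhat_sub_limsup_miss m_gt0 n_gt0 psi_nincr) _.
  apply: negligible_periodic.
  - apply: bigcapT_measurable => K; apply: bigcup_measurable => k _.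
    by apply: measurableC; exact: measurable_hit.
  - apply: periodic_bigcap => K; apply: periodic_bigcup => k.
    by apply: periodicC; exact: periodic_hit.
  - exact: (limsup_miss_prob m_gt0 n_gt0 (fun k => t0 k.+1) h).
(* A set and its complement cannot both be null, since the unit cube has measure [1]; this turns the
   two implications into equivalences. *)
have notboth : lebesgue_null (@Dhat R m n T0 psi) ->
    lebesgue_null (~` @Dhat R m n T0 psi) -> False.
  move=> h1 h2.
  have : (lam R (m * n) m).-negligible setT.
    apply: negligibleS (negligibleU h1 h2) => z _.
    by have [h|h] := pselect (Dhat T0 psi (mx_of_tuple z.1, cV_of_tuple z.2));
      [left|right].
  move=> [A [mA A0 TA]].
  have : (lam R (m * n) m (ucube R (m * n) m) <= lam R (m * n) m A)%E.
    apply: le_measure; rewrite ?inE//; last by move=> z _; exact: TA.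
    exact: measurable_ucube.
  by move: A0 => /= ->; rewrite lam_ucube lee_fin ler10.
split; split.
- by move=> h cv; exact: notboth h (conv cv).
- exact: div.
- by move=> h; apply: contrapT => ncv; exact: notboth (div ncv) h.
- exact: conv.
Qed.
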